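(* Fix any $s,T\in\mathbb{R}$ with $s<-1$ and $T>0$. Then there is no normed space $X_T$ that is a continuously embedded subspace of $C([0,T];\dot H^s(\mathbb{R}^2))$ for which both of the following inequalities hold, with a constant $C>0$ independent of $\phi$ and $u$: $$\big\|e^{itNV}\phi\big\|_{X_T}\leq C\|\phi\|_{\dot H^s(\mathbb{R}^2)}\qquad\text{for all }\phi\in\dot H^s(\mathbb{R}^2),$$ $$\left\|\int_0^te^{i(t-t')NV}\big[NL_1(u)(t')+NL_2(u)(t')\big]\,dt'\right\|_{X_T}\leq C\|u\|_{X_T}^2\qquad\text{for all }u\in X_T,$$ where the expressions inside the $X_T$-norms are regarded as functions of $t\in[0,T]$ with values in functions of $(x,y)$.
   Context: Here $(x,y)\in\mathbb{R}^2$ with dual variables $(\xi,\mu)$, $\partial=\frac12(\partial_x-i\partial_y)$, $\bar\partial=\frac12(\partial_x+i\partial_y)$, and $$NL_1(u)=\tfrac34\,\partial\big(u\,\bar\partial^{-1}\partial u\big),\qquad NL_2(u)=\tfrac34\,\bar\partial\big(u\,\partial^{-1}\bar\partial u\big).$$ The operators $\bar\partial^{-1}\partial$ and $\partial^{-1}\bar\partial$ are the Fourier multipliers with symbols $\frac{i\xi+\mu}{i\xi-\mu}$ and $\frac{i\xi-\mu}{i\xi+\mu}$. The propagator $e^{itNV}$ of the linear equation $\partial_tu+\partial^3u+\bar\partial^3u=0$ is given by $\widehat{e^{itNV}\phi}(\xi,\mu)=e^{it(\frac14\xi^3-\frac34\xi\mu^2)}\hat\phi(\xi,\mu)$. The space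 $\dot H^s(\mathbb{R}^2)$ is the homogeneous Sobolev space with norm $\|\phi\|_{\dot H^s}=\||(\xi,\mu)|^s\hat\phi\|_{L^2_{\xi,\mu}}$. By convention, $\phi$ and $u$ are real-valued. The validity of the inequalities includes that their left-hand sides are well defined as elements of $X_T$. *)

(* Defs.v *)
From mathcomp Require Import all_boot all_order all_algebra.
From mathcomp Require Import all_classical all_reals all_analysis.
From mathcomp Require Import complex.

Set Implicit Arguments.
Unset Strict Implicit.
Unset Printing Implicit Defensive.

Import Order.TTheory GRing.Theory Num.Theory.
Import numFieldNormedType.Exports.

Local Open Scope classical_set_scope.
Local Open Scope ring_scope.
Local Open Scope complex_scope.

(* A tempered distribution on the (x, y)-plane whose Fourier transform is
   locally integrable is represented by that transform, a complex function of
   zeta = (xi, mu) taken up to a.e. equality.  This covers every element of the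
   homogeneous Sobolev space of order s < 1: finiteness of the norm forces local
   integrability.  The normalisation is
     hat phi (zeta) = int exp (- i zeta . (x, y)) phi (x, y) dx dy,
   so d/dx and d/dy have symbols i xi and i mu, and
     hat (phi psi) = (2 pi)^-2 (hat phi * hat psi).
   A function of time is a map R -> R * R -> R[i] of which only the restriction
   to [0, T] is relevant. *)

Section NovikovVeselov.
Variable R : realType.
Implicit Types (s T t rho : R) (z : R * R) (f g phi : R * R -> R[i])
  (u w : R -> R * R -> R[i]).

Definition leb2 : {measure set (measurableTypeR R * measurableTypeR R) -> \bar R} :=
  (@lebesgue_measure R \x @lebesgue_measure R)%E.

Definition cexp (theta : R) : R[i] := cos theta +i* sin theta.

Definition cmod (c : R[i]) : R := ComplexField.Normc.normc c.

Definition enorm2 z : R := Num.sqrt (z.1 ^+ 2 + z.2 ^+ 2).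

Definition cmeasurable f : Prop :=
  measurable_fun [set: measurableTypeR R * measurableTypeR R]
    (fun z => complex.Re (f z)) /\
  measurable_fun [set: measurableTypeR R * measurableTypeR R]
    (fun z => complex.Im (f z)).

Definition cint2 f : R[i] :=
  Rintegral leb2 setT (fun z => complex.Re (f z)) +i*
  Rintegral leb2 setT (fun z => complex.Im (f z)).

Definition cint1 (D : set R) (h : R -> R[i]) : R[i] :=
  Rintegral (@lebesgue_measure R) D (fun t => complex.Re (h t)) +i*
  Rintegral (@lebesgue_measure R) D (fun t => complex.Im (h t)).

Definition eqae f g : Prop := {ae leb2, forall z, f z = g z}.

Definition Hnorm s f : \bar R :=
  Lnorm leb2 2%:E (fun z => (enorm2 z `^ s * cmod (f z))%:E).

(* The Hermitian symmetry says that the represented distribution is real. *)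
Definition Hs s f : Prop :=
  [/\ cmeasurable f,
      eqae (fun z => f (- z)) (fun z => (f z)^*)
    & (Hnorm s f < +oo)%E].

Definition CHs s T u : Prop :=
  (forall t, t \in `[0, T] -> Hs s (u t)) /\
  (forall t, t \in `[0, T] ->
     Hnorm s (fun z => u t' z - u t z) @[t' --> within `[0, T] (nbhs t)] --> 0%E).

Definition eqCHs T u w : Prop := forall t, t \in `[0, T] -> eqae (u t) (w t).

(* A normed space continuously embedded in C([0, T]; H^s), given with its
   inclusion map. *)
Definition continuously_embedded s T (X : normedModType R)
    (iota : X -> R -> R * R -> R[i]) : Prop :=
  [/\ forall x, CHs s T (iota x),
      forall (a : R) (x y : X),
        eqCHs T (iota (a *: x + y)) (fun t z => a%:C * iota x t z + iota y t z),
      forall x y : X, eqCHs T (iota x) (iota y) -> x = y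
    & exists K : R, forall (x : X) t, t \in `[0, T] ->
        (Hnorm s (iota x t) <= (K * `|x|)%:E)%E].

Definition sym_d z : R[i] := (z.2 +i* z.1) / 2.

Definition sym_dbar z : R[i] := (- z.2 +i* z.1) / 2.

Definition NVphase z : R := z.1 ^+ 3 / 4 - 3 / 4 * (z.1 * z.2 ^+ 2).

Definition NVflow t f : R * R -> R[i] := fun z => cexp (t * NVphase z) * f z.

Definition fmul f g : R * R -> R[i] := fun z =>
  ((2 * pi) ^- 2)%:C * cint2 (fun z' => f (z - z') * g z').

Definition NL1 f : R * R -> R[i] := fun z =>
  3 / 4 * sym_d z * fmul f (fun z' => sym_d z' / sym_dbar z' * f z') z.

Definition NL2 f : R * R -> R[i] := fun z =>
  3 / 4 * sym_dbar z * fmul f (fun z' => sym_dbar z' / sym_d z' * f z') z.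

Definition cutoff rho f : R * R -> R[i] := fun z =>
  if enorm2 z <= rho then f z else 0.

(* Duhamel integral of the nonlinearity evaluated at the frequency-truncated
   function.  If u is in C([0, T]; H^s) with s <= 0, the truncation of u t' is
   square integrable with compact support and depends continuously on t', so
   both integrals exist in the classical sense for every z. *)
Definition duhamel_cut rho u t : R * R -> R[i] := fun z =>
  cint1 `[0, t] (fun t' =>
    NVflow (t - t')
      (fun z' => NL1 (cutoff rho (u t')) z' + NL2 (cutoff rho (u t')) z') z).

Fixpoint Ck (k : nat) (psi : R * R -> R) : Prop :=
  continuous psi /\
  match k with
  | 0 => True
  | k'.+1 =>
    [/\ forall z, derivable psi z (1, 0),
        forall z, derivable psi z (0, 1),
        Ck k' (fun z => 'D_(1, 0) psi z)
      & Ck k' (fun z => 'D_(0, 1) psi z)]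
  end.

Definition test_function (psi : R * R -> R) : Prop :=
  (forall k, Ck k psi) /\ exists M : R, forall z, M < enorm2 z -> psi z = 0.

(* w is the Duhamel integral of NL1 u + NL2 u.  For negative s the product of
   two elements of H^s need not converge absolutely, so the quadratic expression
   is understood as the limit, in the sense of distributions in frequency, of
   its values at the truncations of u.  It is the classical integral whenever
   the latter converges absolutely, locally in frequency. *)
Definition is_duhamel T u w : Prop :=
  forall t, t \in `[0, T] -> forall psi, test_function psi ->
    cmod (cint2 (fun z => (psi z)%:C * duhamel_cut rho u t z)
          - cint2 (fun z => (psi z)%:C * w t z)) @[rho --> +oo] --> (0 : R).

Definition linear_estimate s T (X : normedModType R)
    (iota : X -> R -> R * R -> R[i]) (C : R) : Prop :=
  forall phi, Hs s phi ->
    exists x : X, eqCHs T (iota x) (fun t => NVflow t phi) /\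
      (`|x|%:E <= C%:E * Hnorm s phi)%E.

Definition quadratic_estimate T (X : normedModType R)
    (iota : X -> R -> R * R -> R[i]) (C : R) : Prop :=
  forall x : X, exists y : X, is_duhamel T (iota x) (iota y) /\
    `|y| <= C * `|x| ^+ 2.

End NovikovVeselov.

(* Main.v *)
From HB Require Import structures.
Require Import Defs.
From mathcomp Require Import all_boot all_order all_algebra.
From mathcomp Require Import all_classical all_reals all_analysis.
From mathcomp Require Import complex ring lra measurable_realfun.
Import Order.TTheory GRing.Theory Num.Theory.
Import numFieldNormedType.Exports.
Set Implicit Arguments.
Unset Strict Implicit.
Unset Printing Implicit Defensive.
Local Open Scope classical_set_scope.
Local Open Scope ring_scope.
Local Open Scope complex_scope.

(** The two estimates are tested on free waves.  If phi is a datum and u its free evolution,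
    then u lies in the space with norm at most C |phi|, the Duhamel integral of the
    nonlinearity at u has norm at most C^3 |phi|^2, and by the embedding its value at each
    time t in [0, T] has norm at most K C^3 |phi|^2 in the homogeneous Sobolev space.  This
    is violated by high frequencies that interact to produce a low one.

    Take for the transform of phi the indicator of the two boxes N <= |xi| <= N + 3,
    |mu| <= 2 ([datum]); its norm is of order N^s ([Hnorm_datum]).  For an output frequency z
    of size one, every interaction pairs a frequency k of one box with the frequency z - k
    of the other.  Identify (xi, mu) with xi + i mu.  In front of the product of the
    two waves, the two nonlinearities together have the purely imaginary symbol
    i Re (z k^2) / |k|^2, up to a positive constant ([Im_nonlinearity]).  For z in
    [1, 2] x [0, 1] the real factor is at least 1/2 ([symbol_bounds]).  The time frequency of
    the product differs from that of z by (3/4) Re (z (z - k) k), hence it is of order N^2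
    only ([phase_bound]).  So for a time t equal to a small multiple of N^-2 nothing
    oscillates, all contributions add up, and the imaginary part of the Duhamel integral at
    time t is at least a constant times N^-2 on the window ([interaction_total_ge],
    [picard_lower_bound]).  The estimates would therefore give N^-2 <= const * N^(2 s) for
    all large N, which is false for s < -1 ([powers_incompatible]).

    The Duhamel integral is known only through its pairings with test functions, as a limit
    of integrals with truncated frequencies.  The transform of phi has compact support, so
    that the truncation eventually has no effect ([duhamel_cut_datum]), and it suffices to
    pair with one bump supported in the window ([duhamel_pairing]); by Cauchy-Schwarz the
    pairing is controlled by the Sobolev norm ([bump_pairing_le]). *)

(** * A smooth bump *)

Section Bump.
Variable R : realType.
Implicit Types (n : nat) (x y : R) (z : R * R).

(** The classical flat function exp (- 1 / x), extended by 0, and its products with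
    powers of 1 / x: up to linear combinations this family is stable under
    differentiation. *)
Definition flat n x : R := if 0 < x then x^-1 ^+ n * expR (- x^-1) else 0.

Lemma flat_ge0 n x : 0 <= flat n x.
Proof.
rewrite /flat; case: ifP => // x0.
by rewrite mulr_ge0 ?expR_ge0// exprn_ge0// invr_ge0 ltW.
Qed.

(** The exponential beats every power of 1 / x; the quadratic bound is what makes
    flat n continuous and differentiable at 0, with derivative 0. *)
Lemma flat_le n x : flat n x <= n.+2`!%:R * x ^+ 2.
Proof.
rewrite /flat; case: ifPn => x0; last by rewrite mulr_ge0// sqr_ge0.
have y0 : 0 < x^-1 by rewrite invr_gt0.
have H : x^-1 ^+ n.+2 / n.+2`!%:R <= expR x^-1.
  by apply: le_trans (expR_ge1Dxn n.+1 (ltW y0)); rewrite lerDr.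
rewrite expRN ler_pdivrMr ?expR_gt0//.
have fn0 : 0 < n.+2`!%:R :> R by rewrite ltr0n fact_gt0.
rewrite ler_pdivrMr// in H.
apply: (@le_trans _ _ (x ^+ 2 * (x^-1 ^+ n.+2))).
  by rewrite -(addn2 n) exprD mulrCA -exprMn divff ?gt_eqF// expr1n mulr1.
rewrite [leRHS](_ : _ = x ^+ 2 * (expR x^-1 * n.+2`!%:R)); last by ring.
by rewrite ler_wpM2l// sqr_ge0.
Qed.

Lemma flat0_le1 x : flat 0 x <= 1.
Proof.
rewrite /flat; case: ifPn => // x0.
by rewrite expr0 mul1r -[leRHS]expR0 ler_expR oppr_le0 invr_ge0 ltW.
Qed.

Lemma flat0_nd : {homo flat 0 : x y / x <= y}.
Proof.
move=> x y xy; rewrite /flat; case: ifPn => x0; last first.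
  by case: ifPn => // y0; rewrite expr0 mul1r expR_ge0.
have y0 : 0 < y by apply: lt_le_trans xy.
by rewrite y0 !expr0 !mul1r ler_expR lerN2 lef_pV2.
Qed.

Lemma flat0_gt0 x : 0 < x -> 0 < flat 0 x.
Proof. by move=> x0; rewrite /flat x0 expr0 mul1r expR_gt0. Qed.

Lemma flat_npos n x : x <= 0 -> flat n x = 0.
Proof. by move=> x0; rewrite /flat ltNge x0. Qed.

Lemma is_derive_flat n x :
  is_derive x 1 (flat n) (flat n.+2 x - n%:R * flat n.+1 x).
Proof.
have [x0|x0|->] := ltgtP x 0.
- rewrite !flat_npos ?ltW// mulr0 subr0.
  apply: (near_eq_is_derive (f := cst 0)).
  near=> y; rewrite /= flat_npos// ltW//; near: y.
  by apply: lt_nbhsl.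
- apply: (near_eq_is_derive (f := fun x => x^-1 ^+ n * expR (- x^-1))).
    near=> y; rewrite /= /flat ifT//; near: y.
    by apply: lt_nbhsr.
  have dV : is_derive x 1 (fun y : R => y^-1) (- x ^- 2).
    have := @is_deriveV _ (id : R -> R) x 1 1 (lt0r_neq0 x0) (is_derive_id x 1).
    by rewrite /GRing.scale /= mulr1.
  have dE : is_derive x 1 (fun y : R => expR (- y^-1)) (x^-2 * expR (- x^-1)).
    have dN : is_derive x 1 (fun y : R => - y^-1) (x ^-2).
      by rewrite -[X in is_derive _ _ _ X]opprK; exact: is_deriveN.
    have := @is_derive1_comp _ expR (fun y : R => - y^-1) x _ _ (is_derive_expR _) dN.
    by rewrite /GRing.scale/= mulrC.
  have dX := is_deriveX n dV.
  have := is_deriveM dX dE.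
  rewrite (_ : (fun y => y^-1) ^+ n * (fun y => expR (- y^-1)) =
    (fun y => y^-1 ^+ n * expR (- y^-1))); last first.
    by apply/funext => y /=; rewrite mulrfctE exprfctE.
  move=> /is_derive_eq; apply.
  rewrite /flat x0 exprfctE /GRing.scale/= -exprVn -mulr_natl.
  case: n {dX} => [|n]; rewrite ?mul0r ?mulr0 ?addr0 ?subr0 /=;
    by rewrite ?expr0 ?exprS; ring.
- rewrite !flat_npos// mulr0 subr0.
  have cv : (fun h : R => h^-1 *: ((flat n \o shift 0) (h *: (1:R)) - flat n 0))
     @ 0^' --> (0 : R).
    apply/cvgr0Pnorm_le => e e0.
    set K : R := n.+2`!%:R.
    have K0 : 0 < K by rewrite ltr0n fact_gt0.
    near=> h.
    have h0 : h != 0 by near: h; exact: nbhs_dnbhs_neq.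
    rewrite (flat_npos n (lexx 0)) subr0 /= addr0 /GRing.scale /= mulr1 normrM normfV.
    rewrite ler_pdivrMl ?normr_gt0//.
    rewrite (ger0_norm (flat_ge0 _ _)) (le_trans (flat_le _ _))// -/K.
    rewrite -[h ^+ 2]real_normK ?num_real// expr2 mulrCA ler_wpM2l//.
    rewrite mulrC -ler_pdivlMr//; near: h.
    by apply: dnbhs0_le; exact: divr_gt0.
  by split; [apply/cvg_ex; eexists; exact: cv | exact: cvg_lim cv].
Unshelve. all: by end_near. Qed.

Definition bump_term (a b c d : nat) (z : R * R) : R :=
  (flat a (z.1 - 1) * flat b (2 - z.1)) * (flat c z.2 * flat d (1 - z.2)).

(** A set of continuous functions that contains its own partial derivatives consists of
    smooth functions.  Taking the whole span avoids any closed formula for the iterated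
    derivatives of the bump. *)
Inductive bump_span : (R * R -> R) -> Prop :=
| Bump_term a b c d : bump_span (bump_term a b c d)
| Bump_add f g : bump_span f -> bump_span g -> bump_span (fun z => f z + g z)
| Bump_scale k f : bump_span f -> bump_span (fun z => k * f z).

Lemma flat_continuous n : continuous (flat n).
Proof.
move=> x; apply/differentiable_continuous/derivable1_diffP.
by have [] := is_derive_flat n x.
Qed.

Lemma is_derive_prodfst (u v : R -> R) z u' :
  is_derive z.1 1 u u' ->
  is_derive z (1, 0) (fun z => u z.1 * v z.2) (u' * v z.2).
Proof.
case: z => x y /= [du <-].
pose q (h : R) :=
  h^-1 *: (((fun z => u z.1 * v z.2) \o shift (x, y)) (h *: (1 : R, 0 : R)) - u x * v y).
have E : q =
   (fun h : R => (h^-1 *: ((u \o shift x) (h *: (1 : R)) - u x)) * v y).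
  apply/funext => h /=; rewrite /q /= /GRing.scale /= mulr0 add0r -mulrBl.
  by rewrite /GRing.scale /= mulrA.
have cv : q @ 0^' --> 'D_1 u x * v y.
  rewrite E; apply: cvgMl; exact: du.
split; first by apply/cvg_ex; eexists; exact: cv.
exact: cvg_lim cv.
Qed.

Lemma is_derive_prodsnd (u v : R -> R) z v' :
  is_derive z.2 1 v v' ->
  is_derive z (0, 1) (fun z => u z.1 * v z.2) (u z.1 * v').
Proof.
case: z => x y /= [dv <-].
pose q (h : R) :=
  h^-1 *: (((fun z => u z.1 * v z.2) \o shift (x, y)) (h *: (0 : R, 1 : R)) - u x * v y).
have E : q =
   (fun h : R => u x * (h^-1 *: ((v \o shift y) (h *: (1 : R)) - v y))).
  apply/funext => h /=; rewrite /q /= /GRing.scale /= mulr0 add0r -mulrBr.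
  by rewrite /GRing.scale /= mulrCA.
have cv : q @ 0^' --> u x * 'D_1 v y.
  rewrite E; apply: cvgMr; exact: dv.
split; first by apply/cvg_ex; eexists; exact: cv.
exact: cvg_lim cv.
Qed.

Lemma is_derive_flatM a b (r q x : R) :
  is_derive x 1 (fun y => flat a (y - r) * flat b (q - y))
   (flat a.+2 (x - r) * flat b (q - x) - a%:R * (flat a.+1 (x - r) * flat b (q - x))
    - (flat a (x - r) * flat b.+2 (q - x) - b%:R * (flat a (x - r) * flat b.+1 (q - x)))).
Proof.
have d1 : is_derive x 1 (fun y => y - r) (1 : R).
  by rewrite -[X in is_derive _ _ _ X]subr0; exact: is_deriveB.
have d2 : is_derive x 1 (fun y => q - y) (- 1 : R).
  by rewrite -[X in is_derive _ _ _ X]sub0r; exact: is_deriveB.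
have e1 := @is_derive1_comp _ (flat a) (fun y => y - r) x _ _ (is_derive_flat _ _) d1.
have e2 := @is_derive1_comp _ (flat b) (fun y => q - y) x _ _ (is_derive_flat _ _) d2.
have := is_deriveM e1 e2; move=> /is_derive_eq; apply.
by rewrite /GRing.scale/=; ring.
Qed.

Lemma bump_span_derive f : bump_span f ->
  [/\ continuous f,
    (exists2 g, bump_span g & forall z, is_derive z (1, 0) f (g z)) &
    (exists2 g, bump_span g & forall z, is_derive z (0, 1) f (g z))].
Proof.
elim => {f} [a b c d
  |f g _ [cf [f1 sf1 df1] [f2 sf2 df2]] _ [cg [g1 sg1 dg1] [g2 sg2 dg2]]
  |k f _ [cf [f1 sf1 df1] [f2 sf2 df2]]].
- split.
  + move=> z.
    have cf n (g : R * R -> R) :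
        {for z, continuous g} -> {for z, continuous (flat n \o g)}.
      by move=> cg; apply: continuous_comp => //; exact: flat_continuous.
    have c1 : {for z, continuous (flat a \o (fun z : R * R => z.1 - 1))}.
      by apply: cf; apply: cvgB; [exact: cvg_fst | exact: cvg_cst].
    have c2 : {for z, continuous (flat b \o (fun z : R * R => 2 - z.1))}.
      by apply: cf; apply: cvgB; [exact: cvg_cst | exact: cvg_fst].
    have c3 : {for z, continuous (flat c \o (snd : R * R -> R))}.
      by apply: cf; exact: cvg_snd.
    have c4 : {for z, continuous (flat d \o (fun z : R * R => 1 - z.2))}.
      by apply: cf; apply: cvgB; [exact: cvg_cst | exact: cvg_snd].
    exact: (cvgM (cvgM c1 c2) (cvgM c3 c4)).
  + exists (fun z => (bump_term a.+2 b c d z + (- a%:R) * bump_term a.+1 b c d z)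
      + (-1) * (bump_term a b.+2 c d z + (- b%:R) * bump_term a b.+1 c d z)).
      by do ?[apply: Bump_add|apply: Bump_scale|apply: Bump_term].
    move=> z; have /is_derive_eq := is_derive_prodfst (fun y => flat c y * flat d (1 - y))
       (is_derive_flatM a b 1 2 z.1); apply.
    by rewrite /bump_term; ring.
  + exists (fun z => (bump_term a b c.+2 d z + (- c%:R) * bump_term a b c.+1 d z)
      + (-1) * (bump_term a b c d.+2 z + (- d%:R) * bump_term a b c d.+1 z)).
      by do ?[apply: Bump_add|apply: Bump_scale|apply: Bump_term].
    move=> z; have := is_derive_flatM c d 0 1 z.2.
    rewrite (_ : (fun y => _) = (fun y => flat c y * flat d (1 - y))); last first.
      by apply/funext => y; rewrite subr0.
    move=> /(is_derive_prodsnd (fun x => flat a (x - 1) * flat b (2 - x))) /is_derive_eq; apply.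
    by rewrite /bump_term subr0; ring.
- split.
  + by move=> z; apply: cvgD; [exact: cf | exact: cg].
  + by exists (fun z => f1 z + g1 z); [exact: Bump_add | move=> z; exact: is_deriveD].
  + by exists (fun z => f2 z + g2 z); [exact: Bump_add | move=> z; exact: is_deriveD].
- split.
  + by move=> z; apply: cvgMr; exact: cf.
  + by exists (fun z => k * f1 z); [exact: Bump_scale | move=> z; exact: is_deriveZ].
  + by exists (fun z => k * f2 z); [exact: Bump_scale | move=> z; exact: is_deriveZ].
Qed.

Lemma bump_span_Ck k f : bump_span f -> Ck k f.
Proof.
elim: k f => [|k IH] f /bump_span_derive[cf [f1 sf1 df1] [f2 sf2 df2]]; split => //.
split.
- by move=> z; have [] := df1 z.
- by move=> z; have [] := df2 z.
- by rewrite (_ : (fun z => _) = f1); [exact: IH | apply/funext => z; have [] := df1 z].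
- by rewrite (_ : (fun z => _) = f2); [exact: IH | apply/funext => z; have [] := df2 z].
Qed.

(** A smooth nonnegative function with support [1, 2] x [0, 1]. *)
Definition bump := bump_term 0 0 0 0.

Lemma bump_ge0 z : 0 <= bump z.
Proof. by rewrite /bump /bump_term !mulr_ge0// flat_ge0. Qed.

Lemma bump_le1 z : bump z <= 1.
Proof.
have F x : 0 <= flat 0 x <= 1 by rewrite flat_ge0 flat0_le1.
by rewrite /bump /bump_term !mulr_ile1 ?mulr_ge0 ?flat_ge0 ?flat0_le1.
Qed.

Lemma bump_support z : bump z != 0 -> 1 <= z.1 <= 2 /\ 0 <= z.2 <= 1.
Proof.
rewrite /bump /bump_term !mulf_eq0 !negb_or => /andP[/andP[h1 h2] /andP[h3 h4]].
have F x : flat 0 x != 0 -> 0 <= x.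
  by apply: contra_neqT; rewrite -ltNge => /ltW/flat_npos ->.
by move: (F _ h1) (F _ h2) (F _ h3) (F _ h4); rewrite !subr_ge0 => -> -> -> ->.
Qed.

(** Each of the four factors is evaluated at distance at least 1/4 from the end of its
    half line. *)
Lemma bump_ge z : 5 / 4 <= z.1 <= 7 / 4 -> 1 / 4 <= z.2 <= 3 / 4 ->
  flat 0 (1 / 4) ^+ 4 <= bump z.
Proof.
move=> /andP[h1 h2] /andP[h3 h4].
rewrite (_ : _ ^+ 4 = (flat 0 (1 / 4) * flat 0 (1 / 4)) *
  (flat 0 (1 / 4) * flat 0 (1 / 4))); last by ring.
have p := flat_ge0 0 (1/4).
by rewrite !ler_pM ?mulr_ge0//; apply: flat0_nd; lra.
Qed.

Lemma bump_test : test_function bump.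
Proof.
split; first by move=> k; apply: bump_span_Ck; exact: Bump_term.
exists 3 => z; apply: contraPeq => /bump_support[/andP[h1 h2] /andP[h3 h4]].
apply/negP; rewrite -leNgt /enorm2.
have -> : 3 = Num.sqrt (3 ^+ 2) :> R by rewrite sqrtr_sqr ger0_norm.
by rewrite ler_sqrt ?exprn_ge0//; nra.
Qed.

End Bump.

(** * Reflections of the plane *)

Section Reflection.
Variable R : realType.
Implicit Types (z : R * R).

Local Notation plane := (measurableTypeR R * measurableTypeR R)%type.

Lemma measurable_subl (a : R) :
  measurable_fun [set: measurableTypeR R] ((fun x => a - x) : R -> measurableTypeR R).
Proof. by apply: measurable_funB; [exact: measurable_cst|exact: measurable_id]. Qed.

Lemma lebesgue_measure_subl (a : R) (A : set (measurableTypeR R)) : measurable A ->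
  pushforward (@lebesgue_measure R) ((fun x => a - x) : R -> measurableTypeR R) A
  = lebesgue_measure A.
Proof.
move=> mA; apply/esym; apply: (lebesgue_measure_unique _ mA).
  exact: measurable_subl.
move=> mf _ [[p q]] _ <- /=.
rewrite /pushforward (_ : _ @^-1` _ = `[a - q, a - p[%classic); last first.
  by apply/seteqP; split => x /=; rewrite !in_itv/= => /andP[? ?]; apply/andP; split; lra.
rewrite !lebesgue_measure_itv/= !lte_fin.
rewrite ltrD2l ltrN2; case: ifPn => // _.
by rewrite -!EFinB; congr EFin; ring.
Qed.

Lemma measurable_plane_subl (z : plane) :
  measurable_fun [set: plane] ((fun z' => z - z') : plane -> plane).
Proof.
apply/measurable_fun_pairP; split.
- exact: (measurableT_comp (measurable_subl z.1) measurable_fst).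
- exact: (measurableT_comp (measurable_subl z.2) measurable_snd).
Qed.

(** A reflection z' |-> z - z' maps rectangles to rectangles of the same area, and a
    sigma-finite product measure is determined by its values on rectangles. *)
Lemma leb2_subl (z : plane) (A : set plane) : measurable A ->
  leb2 R ((fun z' => z - z') @^-1` A) = leb2 R A.
Proof.
move=> mA; apply/esym.
pose f : plane -> plane := fun z' => z - z'.
rewrite -[RHS]/(pushforward (leb2 R) f A).
apply: (product_measure_unique _ mA).
  exact: measurable_plane_subl.
move=> mf X Y mX mY /=.
rewrite /pushforward.
rewrite (_ : _ @^-1` _ = ((fun x => z.1 - x) @^-1` X) `*` ((fun x => z.2 - x) @^-1` Y)) //.
rewrite product_measure1E//; last 2 first.
  by rewrite -[X in measurable X]setTI; exact: (measurable_subl z.1).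
  by rewrite -[X in measurable X]setTI; exact: (measurable_subl z.2).
by congr *%E; exact: lebesgue_measure_subl.
Qed.

(** Needed because a convolution evaluates a function at z - z': replacing it by an
    almost everywhere equal one must not change the convolution at any point. *)
Lemma ae_leb2_subl (z : plane) (P : plane -> Prop) :
  {ae leb2 R, forall z', P z'} -> {ae leb2 R, forall z', P (z - z')}.
Proof.
move=> [N [mN N0 sN]]; exists ((fun z' => z - z') @^-1` N); split.
- by rewrite -[X in measurable X]setTI; exact: measurable_plane_subl.
- by rewrite leb2_subl.
- by move=> z' /= nP; apply: sN.
Qed.
End Reflection.

(** * Measurability of complex functions and the symbols *)

Section ComplexMeasurable.
Variable R : realType.
Implicit Types (f g F G : R * R -> R[i]) (z : R * R).

Local Notation plane := (measurableTypeR R * measurableTypeR R)%type.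

#[local] Instance ae2_filter : Filter (nbhs (almost_everywhere (leb2 R))).
Proof. exact: ae_filter_ringOfSetsType. Qed.

Lemma ReM (a b : R[i]) : complex.Re (a * b) =
  complex.Re a * complex.Re b - complex.Im a * complex.Im b.
Proof. by case: a b => [? ?] [? ?]. Qed.

Lemma ImM (a b : R[i]) : complex.Im (a * b) =
  complex.Re a * complex.Im b + complex.Im a * complex.Re b.
Proof. by case: a b => [? ?] [? ?]. Qed.

Lemma cmeasurableM f g : cmeasurable f -> cmeasurable g ->
  cmeasurable (fun z => f z * g z).
Proof.
move=> [mf1 mf2] [mg1 mg2]; split.
- under eq_fun do rewrite ReM.
  by apply: measurable_funB; exact: measurable_funM.
- under eq_fun do rewrite ImM.
  by apply: measurable_funD; exact: measurable_funM.
Qed.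

Lemma cmeasurable_subl f z : cmeasurable f -> cmeasurable (fun z' => f (z - z')).
Proof.
by move=> [mf1 mf2]; split; [apply: (measurableT_comp mf1)|apply: (measurableT_comp mf2)];
  exact: measurable_plane_subl.
Qed.

Lemma eq_cint2_ae f g : cmeasurable f -> cmeasurable g -> eqae f g ->
  cint2 f = cint2 g.
Proof.
move=> [mf1 mf2] [mg1 mg2] fg; rewrite /cint2 /Rintegral; congr (fine _ +i* fine _).
- apply: ae_eq_integral => //; [exact/measurable_EFinP|exact/measurable_EFinP|].
  by apply: filterS fg => z /= ->.
- apply: ae_eq_integral => //; [exact/measurable_EFinP|exact/measurable_EFinP|].
  by apply: filterS fg => z /= ->.
Qed.

Lemma fmul_ae (m : R * R -> R[i]) F G z : cmeasurable m -> cmeasurable F -> cmeasurable G ->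
  eqae F G -> fmul F (fun z' => m z' * F z') z = fmul G (fun z' => m z' * G z') z.
Proof.
move=> mm mF mG FG; rewrite /fmul; congr (_ * _); apply: eq_cint2_ae.
- by apply: cmeasurableM; [exact: cmeasurable_subl|exact: cmeasurableM].
- by apply: cmeasurableM; [exact: cmeasurable_subl|exact: cmeasurableM].
- have FG' := @ae_leb2_subl R z _ FG.
  by apply: filterS2 FG FG' => z' /= -> ->.
Qed.

(** For k = k.1 + i k.2, the complex number symRe k + i symIm k is k^2 / |k|^2, and the
    multipliers of the two nonlocal operators are it and its conjugate. *)
Definition symRe z : R := (z.1 ^+ 2 - z.2 ^+ 2) * (z.1 ^+ 2 + z.2 ^+ 2)^-1.
Definition symIm z : R := 2 * (z.1 * z.2) * (z.1 ^+ 2 + z.2 ^+ 2)^-1.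

Lemma half_complex (a b : R) : (a +i* b) / 2 = (a / 2) +i* (b / 2).
Proof.
rewrite -[2 in LHS](rmorph_nat (real_complex R) 2) -fmorphV /=.
by rewrite mulrC; apply/eqP; rewrite eq_complex /= !mul0r subr0 addr0 !(mulrC 2^-1) !eqxx.
Qed.

Lemma conj_ratio (a b : R) :
  (b +i* a) / ((- b) +i* a) =
  ((a ^+ 2 - b ^+ 2) * (a ^+ 2 + b ^+ 2)^-1) -i* (2 * (a * b) * (a ^+ 2 + b ^+ 2)^-1).
Proof.
apply/eqP; rewrite eq_complex /=.
by rewrite sqrrN (addrC (b ^+ 2)); apply/andP; split; apply/eqP; ring.
Qed.

Lemma sym_d_ratio z : sym_d z / sym_dbar z = symRe z -i* symIm z.
Proof.
rewrite /sym_d /sym_dbar invfM mulrACA divff ?mulr1 ?conj_ratio;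
  last by rewrite invr_eq0 pnatr_eq0.
by [].
Qed.

Lemma sym_dbar_ratio z : sym_dbar z / sym_d z = symRe z +i* symIm z.
Proof.
rewrite /sym_d /sym_dbar invfM mulrACA divff ?mulr1; last by rewrite invr_eq0 pnatr_eq0.
have := conj_ratio z.1 (- z.2); rewrite opprK sqrrN => ->.
by congr (_ +i* _); rewrite /symIm; ring.
Qed.

Lemma measurable_fst_plane : measurable_fun [set: plane] (fun z : plane => z.1 : R).
Proof. exact: measurable_fst. Qed.
Lemma measurable_snd_plane : measurable_fun [set: plane] (fun z : plane => z.2 : R).
Proof. exact: measurable_snd. Qed.

Lemma measurable_normsq d (T : measurableType d) (a b : T -> R) :
  measurable_fun [set: T] a -> measurable_fun [set: T] b ->
  measurable_fun [set: T] (fun p => (a p ^+ 2 + b p ^+ 2)).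
Proof.
by move=> ma mb; apply: measurable_funD; exact: measurable_funX.
Qed.

(** The inverse agrees with the real power of exponent -1 on nonnegative arguments. *)
Lemma measurable_normsqV d (T : measurableType d) (a b : T -> R) :
  measurable_fun [set: T] a -> measurable_fun [set: T] b ->
  measurable_fun [set: T] (fun p => (a p ^+ 2 + b p ^+ 2)^-1).
Proof.
move=> ma mb; rewrite (_ : (fun p => _) =
  (fun x : R => x `^ (- 1)) \o (fun p => a p ^+ 2 + b p ^+ 2)).
  by apply: measurableT_comp; [exact: measurable_powR|exact: measurable_normsq].
by apply/funext => p /=; rewrite powR_inv1// addr_ge0// sqr_ge0.
Qed.

Lemma measurable_symRe d (T : measurableType d) (a b : T -> R) :
  measurable_fun [set: T] a -> measurable_fun [set: T] b ->
  measurable_fun [set: T] (fun p => symRe (a p, b p)).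
Proof.
move=> ma mb; apply: measurable_funM; last exact: measurable_normsqV.
by apply: measurable_funB; exact: measurable_funX.
Qed.

Lemma measurable_symIm d (T : measurableType d) (a b : T -> R) :
  measurable_fun [set: T] a -> measurable_fun [set: T] b ->
  measurable_fun [set: T] (fun p => symIm (a p, b p)).
Proof.
move=> ma mb; apply: measurable_funM; last exact: measurable_normsqV.
apply: measurable_funM; first exact: measurable_cst.
exact: measurable_funM.
Qed.

Lemma cmeasurable_ratio1 : cmeasurable (fun z => sym_d z / sym_dbar z).
Proof.
rewrite (_ : (fun z => _) = (fun z => symRe (z.1, z.2) -i* symIm (z.1, z.2))); last first.
  by apply/funext => -[x y]; exact: sym_d_ratio.
split => /=.
  by apply: measurable_symRe; [exact: measurable_fst_plane|exact: measurable_snd_plane].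
apply: measurable_funN.
by apply: measurable_symIm; [exact: measurable_fst_plane|exact: measurable_snd_plane].
Qed.

Lemma cmeasurable_ratio2 : cmeasurable (fun z => sym_dbar z / sym_d z).
Proof.
rewrite (_ : (fun z => _) = (fun z => symRe (z.1, z.2) +i* symIm (z.1, z.2))); last first.
  by apply/funext => -[x y]; exact: sym_dbar_ratio.
split => /=.
  by apply: measurable_symRe; [exact: measurable_fst_plane|exact: measurable_snd_plane].
by apply: measurable_symIm; [exact: measurable_fst_plane|exact: measurable_snd_plane].
Qed.

(** At every point, since the nonlinearities are convolutions of values of the function. *)
Lemma NL_ae F G z : cmeasurable F -> cmeasurable G -> eqae F G ->
  NL1 F z + NL2 F z = NL1 G z + NL2 G z.
Proof.
move=> mF mG FG; rewrite /NL1 /NL2.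
by rewrite (fmul_ae z cmeasurable_ratio1 mF mG FG) (fmul_ae z cmeasurable_ratio2 mF mG FG).
Qed.

End ComplexMeasurable.

(** * Integrals of functions dominated by an indicator *)

Section BoundedIntegrals.
Context d (T : measurableType d) (R : realType) (m : {measure set T -> \bar R}).
Implicit Types (f g : T -> R) (E S : set T).

Lemma integrable_indicM M E : measurable E -> (m E < +oo)%E ->
  m.-integrable [set: T] (EFin \o (fun x => M * \1_E x)).
Proof.
move=> mE Efin; under [EFin \o _]funext do rewrite /= EFinM.
apply: integrableZl => //; apply/integrableP; split; first exact/measurable_EFinP.
under eq_integral => t _ do rewrite gee0_abs ?lee_fin//.
by rewrite integral_indic// setIT.
Qed.

Lemma integrable_bounded f M E : measurable_fun [set: T] f -> measurable E ->
  (m E < +oo)%E -> (forall x, `|f x| <= M * \1_E x) ->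
  m.-integrable [set: T] (EFin \o f).
Proof.
move=> mf mE Efin fE.
apply: (@le_integrable _ _ _ m _ measurableT _ (EFin \o (fun x => M * \1_E x))).
- exact/measurable_EFinP.
- by move=> x _ /=; rewrite lee_fin (le_trans (fE x))// ler_norm.
- exact: integrable_indicM.
Qed.

Lemma Rintegral_indicM M E : measurable E -> (m E < +oo)%E ->
  Rintegral m setT (fun x => M * \1_E x) = M * fine (m E).
Proof.
move=> mE Efin; rewrite RintegralZl//; last first.
  by have := integrable_indicM 1 mE Efin; under [EFin \o _]funext do rewrite /= mul1r.
by rewrite /Rintegral integral_indic// setIT.
Qed.

Lemma Rintegral_le_indic f M E : measurable_fun [set: T] f -> measurable E ->
  (m E < +oo)%E -> (forall x, 0 <= f x <= M * \1_E x) ->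
  0 <= Rintegral m setT f <= M * fine (m E).
Proof.
move=> mf mE Efin fE; apply/andP; split.
  by apply: Rintegral_ge0 => x _; have /andP[] := fE x.
rewrite -Rintegral_indicM//; apply: le_Rintegral => //.
- apply: (integrable_bounded (M := M) mf mE Efin) => x.
  by have /andP[f0 fM] := fE x; rewrite ger0_norm.
- exact: integrable_indicM.
- by move=> x _; have /andP[] := fE x.
Qed.

Lemma Rintegral_ge_indic f M E c S : measurable_fun [set: T] f -> measurable E ->
  (m E < +oo)%E -> measurable S -> (m S < +oo)%E ->
  (forall x, `|f x| <= M * \1_E x) -> (forall x, c * \1_S x <= f x) ->
  c * fine (m S) <= Rintegral m setT f.
Proof.
move=> mf mE Efin mS Sfin fE cf.
rewrite -Rintegral_indicM//; apply: le_Rintegral => //.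
- exact: integrable_indicM.
- exact: (integrable_bounded (M := M) mf mE Efin).
Qed.

Lemma Rintegral_lin2 f g (k l : R) :
  m.-integrable setT (EFin \o f) -> m.-integrable setT (EFin \o g) ->
  Rintegral m setT (fun x => k * f x + l * g x) =
  k * Rintegral m setT f + l * Rintegral m setT g.
Proof.
move=> mf mg; have Z h (r : R) : m.-integrable setT (EFin \o h) ->
    m.-integrable setT (EFin \o (fun x => r * h x)).
  by move=> ih; under [EFin \o _]funext do rewrite /= EFinM; exact: integrableZl.
by rewrite RintegralD//; [rewrite !RintegralZl|exact: Z|exact: Z].
Qed.

End BoundedIntegrals.

(** Tonelli's theorem: it is what allows the frequency and time integrals of the Duhamel
    formula to be integrated again. *)
Lemma measurable_Rintegral_param d1 d2 (T1 : measurableType d1) (T2 : measurableType d2)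
  (R : realType) (m : {sigma_finite_measure set T2 -> \bar R}) (f : T1 * T2 -> R) :
  measurable_fun [set: T1 * T2] f -> (forall p, 0 <= f p) ->
  measurable_fun [set: T1] (fun x => Rintegral m setT (fun y => f (x, y))).
Proof.
move=> mf f0; apply: (measurableT_comp (fine_measurable measurableT)).
apply: (measurable_fun_fubini_tonelli_F (EFin \o f)) => //.
exact/measurable_EFinP.
Qed.

(** * The support of the datum *)

Section Datum.
Variable R : realType.
Implicit Types (N t : R) (z : R * R).
Local Notation plane := (measurableTypeR R * measurableTypeR R)%type.

Definition slab N : set (measurableTypeR R) := [set x : R | N <= `|x| <= N + 3].
Definition strip : set (measurableTypeR R) := `[-2, 2]%classic.

(** Indicator of the two boxes N <= |z.1| <= N + 3, |z.2| <= 2.  They are exchanged by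
    z |-> - z, so that it is the Fourier transform of a real function. *)
Definition chi N z : R := \1_(slab N) z.1 * \1_strip z.2.

Lemma measurable_slab N : measurable (slab N).
Proof.
rewrite -[X in measurable X]setTI (_ : slab N = Num.norm @^-1` `[N, N + 3]%classic).
  by apply: normr_measurable.
by apply/seteqP; split => x /=; rewrite in_itv.
Qed.

Lemma measurable_chi d (T : measurableType d) N (a b : T -> R) :
  measurable_fun [set: T] a -> measurable_fun [set: T] b ->
  measurable_fun [set: T] (fun p => chi N (a p, b p)).
Proof.
move=> ma mb; apply: measurable_funM.
  by apply: (measurableT_comp _ ma); exact: measurable_indic (measurable_slab N).
by apply: (measurableT_comp _ mb); apply: measurable_indic; exact: measurable_itv.
Qed.

Lemma chiE N : chi N = \1_(slab N `*` strip).
Proof.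
apply/funext => z; rewrite /chi !indicE -natrM mulnb; congr (_ %:R).
by congr nat_of_bool; rewrite in_setX.
Qed.

Lemma lebesgue_segment (a b : R) : a < b ->
  lebesgue_measure (`[a, b]%classic : set (measurableTypeR R)) = (b - a)%:E.
Proof. by move=> ab; rewrite lebesgue_measure_itv/= lte_fin ab -EFinB. Qed.

Lemma lebesgue_slab N : 0 <= N -> (lebesgue_measure (slab N) <= 6%:E)%E.
Proof.
move=> N0.
have sub : slab N `<=` `[N, N + 3] `|` `[- (N + 3), - N].
  move=> x /= /andP[h1 h2]; rewrite !in_itv/=.
  by case: (ger0P x) h1 h2 => x0 h1 h2; [left|right]; apply/andP; split; lra.
have m1 : measurable (`[N, N + 3]%classic : set (measurableTypeR R)) by exact: measurable_itv.
have m2 : measurable (`[- (N + 3), - N]%classic : set (measurableTypeR R)).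
  exact: measurable_itv.
apply: (le_trans (le_measure _ _ _ sub)); rewrite ?inE;
  [exact: measurable_slab|exact: measurableU|].
apply: (le_trans (measureU2 _ m1 m2)).
pose I1 : set (measurableTypeR R) := `[N, N + 3]%classic.
pose I2 : set (measurableTypeR R) := `[- (N + 3), - N]%classic.
have e1 : (lebesgue_measure I1 <= 3%:E)%E.
  by rewrite lebesgue_segment; [rewrite lee_fin|]; lra.
have e2 : (lebesgue_measure I2 <= 3%:E)%E.
  by rewrite lebesgue_segment; [rewrite lee_fin|]; lra.
by apply: (le_trans (leeD e1 e2)); rewrite -EFinD lee_fin; lra.
Qed.

Lemma leb2_rect (A B : set (measurableTypeR R)) : measurable A -> measurable B ->
  leb2 R (A `*` B) = (lebesgue_measure A * lebesgue_measure B)%E.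
Proof. by move=> mA mB; exact: product_measure1E. Qed.

(** The bound does not depend on N: as N grows the boxes move, with a fixed size. *)
Lemma leb2_band N : 0 <= N -> (leb2 R (slab N `*` strip) <= 24%:E)%E.
Proof.
move=> N0; rewrite leb2_rect; [|exact: measurable_slab|exact: measurable_itv].
rewrite [X in (_ * X)%E](_ : _ = 4%:E).
  rewrite -[24%:E](_ : 6%:E * 4%:E = _)%E; last by rewrite -EFinM; congr EFin; ring.
  by apply: lee_pmul => //; exact: lebesgue_slab.
by rewrite /strip (@lebesgue_segment (-2) 2); [congr EFin; lra|lra].
Qed.

Lemma measurable_band N : measurable (slab N `*` strip : set plane).
Proof. by apply: measurableX; [exact: measurable_slab|exact: measurable_itv]. Qed.

Lemma band_fin N : 0 <= N -> (leb2 R (slab N `*` strip) < +oo)%E.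
Proof. by move=> N0; apply: (le_lt_trans (leb2_band N0)); rewrite ltry. Qed.

Lemma chi_ge0 N z : 0 <= chi N z.
Proof. by rewrite chiE. Qed.

Lemma chi_le1 N z : chi N z <= 1.
Proof. by rewrite chiE indicE; case: (_ \in _). Qed.

End Datum.

(** * The nonlinearity of a free wave *)

Section Formula.
Variable R : realType.
Implicit Types (N t s : R) (z k : R * R).
Local Notation plane := (measurableTypeR R * measurableTypeR R)%type.

Definition datum N z : R[i] := (chi N z)%:C.

Lemma measurable_NVphase d (T : measurableType d) (a b : T -> R) :
  measurable_fun [set: T] a -> measurable_fun [set: T] b ->
  measurable_fun [set: T] (fun p => NVphase (a p, b p)).
Proof.
move=> ma mb; apply: measurable_funB => /=.
  by apply: measurable_funM => //; exact: measurable_funX.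
apply: measurable_funM => //; apply: measurable_funM => //; exact: measurable_funX.
Qed.

Lemma measurable_cos d (T : measurableType d) (a : T -> R) :
  measurable_fun [set: T] a -> measurable_fun [set: T] (fun p => cos (a p)).
Proof.
move=> ma; apply: (measurableT_comp _ ma).
by apply: continuous_measurable_fun; exact: continuous_cos.
Qed.

Lemma measurable_sin d (T : measurableType d) (a : T -> R) :
  measurable_fun [set: T] a -> measurable_fun [set: T] (fun p => sin (a p)).
Proof.
move=> ma; apply: (measurableT_comp _ ma).
by apply: continuous_measurable_fun; exact: continuous_sin.
Qed.

(** The phase acquired up to time s by the product of two free waves of frequencies z - k
    and k. *)
Definition pairphase s z k : R := s * (NVphase (z - k) + NVphase k).

Lemma measurable_pairphase d (T : measurableType d) (s x y a b : T -> R) :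
  measurable_fun [set: T] s ->
  measurable_fun [set: T] x -> measurable_fun [set: T] y ->
  measurable_fun [set: T] a -> measurable_fun [set: T] b ->
  measurable_fun [set: T] (fun p => pairphase (s p) (x p, y p) (a p, b p)).
Proof.
move=> ms mx my ma mb; apply: measurable_funM => //.
apply: measurable_funD; last exact: measurable_NVphase.
by apply: measurable_NVphase; exact: measurable_funB.
Qed.

Definition pairchi N z k : R := chi N (z - k) * chi N k.

Lemma measurable_pairchi d (T : measurableType d) N (x y a b : T -> R) :
  measurable_fun [set: T] x -> measurable_fun [set: T] y ->
  measurable_fun [set: T] a -> measurable_fun [set: T] b ->
  measurable_fun [set: T] (fun p => pairchi N (x p, y p) (a p, b p)).
Proof.
move=> mx my ma mb; apply: measurable_funM; last exact: measurable_chi.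
by apply: measurable_chi; exact: measurable_funB.
Qed.

Lemma symRe_le1 k : `|symRe k| <= 1.
Proof.
rewrite /symRe normrM normfV (@ger0_norm _ (k.1 ^+ 2 + k.2 ^+ 2)) ?addr_ge0 ?sqr_ge0//.
have [->|h0] := eqVneq (k.1 ^+ 2 + k.2 ^+ 2) 0; first by rewrite invr0 mulr0.
have h : 0 < k.1 ^+ 2 + k.2 ^+ 2 by rewrite lt_def h0 addr_ge0 ?sqr_ge0.
rewrite ler_pdivrMr// mul1r ler_norml; have := sqr_ge0 k.1; have := sqr_ge0 k.2; lra.
Qed.

Lemma symIm_le1 k : `|symIm k| <= 1.
Proof.
rewrite /symIm normrM normfV (@ger0_norm _ (k.1 ^+ 2 + k.2 ^+ 2)) ?addr_ge0 ?sqr_ge0//.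
have [->|h0] := eqVneq (k.1 ^+ 2 + k.2 ^+ 2) 0; first by rewrite invr0 mulr0.
have h : 0 < k.1 ^+ 2 + k.2 ^+ 2 by rewrite lt_def h0 addr_ge0 ?sqr_ge0.
rewrite ler_pdivrMr// mul1r ler_norml.
have := sqr_ge0 (k.1 - k.2); have := sqr_ge0 (k.1 + k.2).
by rewrite !expr2 => *; apply/andP; split; lra.
Qed.

Lemma pairchi_ge0 N z k : 0 <= pairchi N z k.
Proof. by rewrite mulr_ge0 ?chi_ge0. Qed.

Lemma pairchi_le N z k : pairchi N z k <= \1_(slab N `*` @strip R) k.
Proof. by rewrite -chiE ler_piMl ?chi_ge0 ?chi_le1. Qed.

Lemma integrable_pairchi N z (f g : R * R -> R) : 0 <= N ->
  measurable_fun [set: plane] f -> measurable_fun [set: plane] g ->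
  (forall k, `|f k| <= 1) -> (forall k, `|g k| <= 1) ->
  (leb2 R).-integrable setT (EFin \o (fun k => f k * g k * pairchi N z k)).
Proof.
move=> N0 mf mg f1 g1.
apply: (integrable_bounded (M := 1) _ (measurable_band N) (band_fin N0)) => [|k].
  apply: measurable_funM; first exact: measurable_funM.
  rewrite (_ : pairchi N z = (fun k => pairchi N (z.1, z.2) (k.1, k.2))); last first.
    by apply/funext => k; rewrite -!surjective_pairing.
  by apply: measurable_pairchi => //.
rewrite normrM (ger0_norm (pairchi_ge0 _ _ _)) normrM mul1r.
apply: le_trans (pairchi_le N z k).
by rewrite ler_piMl ?pairchi_ge0// mulr_ile1.
Qed.

(** Read as complex numbers, z.1 * symRe k - z.2 * symIm k is the real part of z k^2 / |k|^2:
    the symbols of the two nonlinearities add up to i times this real number, up to the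
    constant 3 / 4.  The factor (2 pi)^-2 comes from the convolution. *)
Definition density N s z t' k : R :=
  3 / 4 * (2 * pi) ^- 2 * ((z.1 * symRe k - z.2 * symIm k)
   * cos ((s - t') * NVphase z + pairphase t' z k) * pairchi N z k).

(** With k^2 / |k|^2 = P + i Q and i beta the phase of the product of the two waves, the
    two convolutions are the integrals of (P - i Q) exp (i beta) and (P + i Q) exp (i beta).
    Multiplied by the symbols of the outer derivatives, which are i / 2 times the conjugate
    of z and i / 2 times z, they add up to i times the integral of
    (z.1 P - z.2 Q) exp (i beta).  Only the imaginary part is kept: there the phase enters
    through a cosine, which is positive for short times. *)
Lemma Im_nonlinearity N s t' z : 0 <= N ->
  complex.Im (NVflow (s - t') (fun z' =>
    NL1 (NVflow t' (datum N)) z' + NL2 (NVflow t' (datum N)) z') z) =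
  Rintegral (leb2 R) setT (density N s z t').
Proof.
move=> N0.
set G := NVflow t' (datum N).
pose C k := cos (pairphase t' z k); pose S k := sin (pairphase t' z k).
pose fPC k := symRe k * C k * pairchi N z k.
pose fPS k := symRe k * S k * pairchi N z k.
pose fQC k := symIm k * C k * pairchi N z k.
pose fQS k := symIm k * S k * pairchi N z k.
have mphase : measurable_fun [set: plane] (pairphase t' z).
  rewrite (_ : pairphase t' z = (fun k => pairphase t' (z.1, z.2) (k.1, k.2))); last first.
    by apply/funext => k; rewrite -!surjective_pairing.
  by apply: measurable_pairphase => //.
have mP : measurable_fun [set: plane] (@symRe R).
  rewrite (_ : @symRe R = (fun k => symRe (k.1, k.2))); last by apply/funext => -[].
  by apply: measurable_symRe; [exact: measurable_fst_plane|exact: measurable_snd_plane].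
have mQ : measurable_fun [set: plane] (@symIm R).
  rewrite (_ : @symIm R = (fun k => symIm (k.1, k.2))); last by apply/funext => -[].
  by apply: measurable_symIm; [exact: measurable_fst_plane|exact: measurable_snd_plane].
have mC : measurable_fun [set: plane] C by exact: measurable_cos.
have mS : measurable_fun [set: plane] S by exact: measurable_sin.
have C1 k : `|C k| <= 1 by rewrite ler_norml cos_geN1 cos_le1.
have S1 k : `|S k| <= 1 by rewrite ler_norml sin_geN1 sin_le1.
have iPC := integrable_pairchi z N0 mP mC symRe_le1 C1.
have iPS := integrable_pairchi z N0 mP mS symRe_le1 S1.
have iQC := integrable_pairchi z N0 mQ mC symIm_le1 C1.
have iQS := integrable_pairchi z N0 mQ mS symIm_le1 S1.
pose I f := Rintegral (leb2 R) setT f.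
have prod k : G (z - k) * G k = (C k * pairchi N z k) +i* (S k * pairchi N z k).
  apply/eqP; rewrite eq_complex /G /NVflow /cexp /datum /C /S /pairphase /pairchi.
  move: (NVphase (z - k)) (NVphase k) => u v; rewrite (mulrDr t' u v) cosD sinD.
  by rewrite /=; apply/andP; split; apply/eqP; ring.
have E1 : cint2 (fun k => G (z - k) * (sym_d k / sym_dbar k * G k))
   = (I fPC + I fQS) +i* (I fPS - I fQC).
  rewrite /cint2 /I -RintegralD// -RintegralB//; congr (_ +i* _); apply: eq_Rintegral => k _;
    rewrite mulrCA prod sym_d_ratio /fPC /fQS /fPS /fQC /=; ring.
have E2 : cint2 (fun k => G (z - k) * (sym_dbar k / sym_d k * G k))
   = (I fPC - I fQS) +i* (I fPS + I fQC).
  rewrite /cint2 /I -RintegralD// -RintegralB//; congr (_ +i* _); apply: eq_Rintegral => k _;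
    rewrite mulrCA prod sym_dbar_ratio /fPC /fQS /fPS /fQC /=; ring.
rewrite {1}/NVflow /NL1 /NL2 /fmul E1 E2.
have -> : sym_d z = (z.2 / 2) +i* (z.1 / 2) by rewrite -half_complex.
have -> : sym_dbar z = (- z.2 / 2) +i* (z.1 / 2) by rewrite -half_complex.
have -> : (3 / 4 : R[i]) = (3 / 4 : R)%:C by rewrite !(rmorphM, fmorphV, rmorph_nat).
set c : R := (2 * pi) ^- 2.
set g := (s - t') * NVphase z.
transitivity (3 / 4 * c * (cos g * (z.1 * I fPC - z.2 * I fQC) +
                           sin g * (z.2 * I fQS - z.1 * I fPS))).
  by rewrite /cexp /=; field.
have lin f h a b : (leb2 R).-integrable setT (EFin \o f) ->
    (leb2 R).-integrable setT (EFin \o h) ->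
    (leb2 R).-integrable setT (EFin \o (fun x => a * f x + b * h x)).
  move=> if_ ih; have Z r f' : (leb2 R).-integrable setT (EFin \o f') ->
      (leb2 R).-integrable setT (EFin \o (fun x => r * f' x)).
    by move=> i; under [EFin \o _]funext do rewrite /= EFinM; exact: integrableZl.
  under [EFin \o _]funext do rewrite /= EFinD.
  by apply: integrableD => //; exact: Z.
pose f1 k := z.1 * fPC k + (- z.2) * fQC k.
pose f2 k := z.2 * fQS k + (- z.1) * fPS k.
have if1 : (leb2 R).-integrable setT (EFin \o f1) by exact: lin.
have if2 : (leb2 R).-integrable setT (EFin \o f2) by exact: lin.
transitivity (3 / 4 * c * cos g * I f1 + 3 / 4 * c * sin g * I f2).
  by rewrite /I /f1 /f2 !Rintegral_lin2//; ring.
rewrite /I -Rintegral_lin2//; apply: eq_Rintegral => k _.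
rewrite /density -/c -/g cosD /f1 /f2 /fPC /fPS /fQC /fQS /C /S; ring.
Qed.

End Formula.

(** * Size of the symbol and of the phase *)

Section SymbolPhase.
Variable R : realType.
Implicit Types (N t s : R) (z k : R * R).

Lemma chi_neq0 N k : chi N k != 0 -> N <= `|k.1| <= N + 3 /\ `|k.2| <= 2.
Proof.
rewrite /chi !indicE mulf_eq0 negb_or !pnatr_eq0 !eqb0 !negbK.
by move=> /andP[/set_mem h1 /set_mem]; rewrite /strip/= in_itv/= -ler_norml.
Qed.

(** Far out along the first axis k^2 / |k|^2 is close to 1, so the real part of
    z k^2 / |k|^2 is close to z.1. *)
Lemma symbol_bounds N z k : 10 <= N -> 1 <= z.1 <= 2 -> 0 <= z.2 <= 1 ->
  N <= `|k.1| <= N + 3 -> `|k.2| <= 2 ->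
  1 / 2 <= z.1 * symRe k - z.2 * symIm k <= 3.
Proof.
move=> N10 /andP[x1 x2] /andP[y0 y1] /andP[Na aN] b2.
apply/andP; split; last first.
  have := symRe_le1 k; have := symIm_le1 k.
  by rewrite !ler_norml => /andP[? ?] /andP[? ?]; nra.
have a2 : 100 <= k.1 ^+ 2 by rewrite -(@real_normK _ k.1) ?num_real//; nra.
have bb : k.2 ^+ 2 <= 4.
  by rewrite -(@real_normK _ k.2) ?num_real//; have := normr_ge0 k.2; nra.
have D0 : 0 < k.1 ^+ 2 + k.2 ^+ 2 by have := sqr_ge0 k.2; lra.
rewrite /symRe /symIm [X in _ <= X](_ : _ =
  (z.1 * (k.1 ^+ 2 - k.2 ^+ 2) - z.2 * (2 * (k.1 * k.2))) /
  (k.1 ^+ 2 + k.2 ^+ 2)); last by ring.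
rewrite ler_pdivlMr//.
have h1 : k.1 ^+ 2 - k.2 ^+ 2 <= z.1 * (k.1 ^+ 2 - k.2 ^+ 2) by nra.
have h2 : z.2 * (2 * (k.1 * k.2)) <= k.1 ^+ 2 / 4 + 4 * k.2 ^+ 2.
  have : z.2 * (2 * (k.1 * k.2)) <= k.1 ^+ 2 / 4 + 4 * (z.2 * k.2) ^+ 2.
    by have := sqr_ge0 (k.1 / 2 - 2 * (z.2 * k.2)); rewrite !expr2; lra.
  have : (z.2 * k.2) ^+ 2 <= k.2 ^+ 2.
    by rewrite exprMn ler_piMl ?sqr_ge0// expr_le1.
  lra.
lra.
Qed.

(** Although each of the two waves oscillates at frequency N^3 in time, their product does
    so only at frequency N^2. *)
Lemma phase_bound N s t z k : 10 <= N -> 1 <= z.1 <= 2 -> 0 <= z.2 <= 1 ->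
  N <= `|k.1| <= N + 3 -> `|k.2| <= 2 ->
  N <= `|z.1 - k.1| <= N + 3 -> `|z.2 - k.2| <= 2 -> 0 <= t <= s ->
  `|(s - t) * NVphase z + pairphase t z k| <= s * (5 * N ^+ 2).
Proof.
move=> N10 /andP[x1 x2] /andP[y0 y1] /andP[_ a1] b1 /andP[_ a2] b2 /andP[t0 ts].
(* W is the real part of the product of z, z - k and k read as complex numbers,
   and 3/4 W is the defect NVphase z - NVphase (z - k) - NVphase k: the cubic
   terms in k cancel, which leaves a quantity quadratic in N. *)
pose W := z.1 * ((z.1 - k.1) * k.1 - (z.2 - k.2) * k.2) -
          z.2 * ((z.1 - k.1) * k.2 + (z.2 - k.2) * k.1).
have -> : (s - t) * NVphase z + pairphase t z k = s * NVphase z - t * (3 / 4 * W).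
  by rewrite /W /pairphase /NVphase /=; field.
have phi : `|NVphase z| <= 4.
  rewrite /NVphase; apply: (le_trans (ler_normB _ _)).
  have p : 0 <= z.1 ^+ 3 <= 8.
    apply/andP; split; first by rewrite exprn_ge0//; lra.
    by rewrite (_ : 8 = 2 ^+ 3); [rewrite lerXn2r ?nnegrE//; lra|ring].
  have q : 0 <= z.1 * z.2 ^+ 2 <= 2.
    have : 0 <= z.2 ^+ 2 <= 1 by rewrite sqr_ge0 expr_le1.
    by move=> /andP[? ?]; apply/andP; split; nra.
  by rewrite !ger0_norm; lra.
have aa : `|(z.1 - k.1) * k.1| <= (N + 3) * (N + 3) by rewrite normrM ler_pM.
have bb : `|(z.2 - k.2) * k.2| <= 4 by rewrite normrM (_ : 4 = 2 * 2); [rewrite ler_pM|ring].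
have ab : `|(z.1 - k.1) * k.2| <= (N + 3) * 2 by rewrite normrM ler_pM.
have ba : `|(z.2 - k.2) * k.1| <= 2 * (N + 3) by rewrite normrM ler_pM.
have w : `|W| <= 2 * ((N + 3) * (N + 3) + 4) + 4 * (N + 3).
  apply: (le_trans (ler_normB _ _)); rewrite !normrM (ger0_norm (_ : 0 <= z.1)); last lra.
  rewrite (ger0_norm y0); apply: lerD.
    by apply: ler_pM => //; [lra|apply: (le_trans (ler_normB _ _)); lra].
  rewrite -[leRHS]mul1r; apply: ler_pM => //.
  by apply: (le_trans (ler_normD _ _)); lra.
apply: (le_trans (ler_normB _ _)); rewrite (normrM s) (normrM t) (normrM (3 / 4)).
rewrite (ger0_norm (_ : 0 <= s)); last lra.
rewrite (ger0_norm t0) (ger0_norm (_ : 0 <= 3 / 4)); last lra.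
apply: (@le_trans _ _ (s * 4 + s * (3 / 4 * (2 * ((N + 3) * (N + 3) + 4) + 4 * (N + 3))))).
  apply: lerD; first by rewrite ler_wpM2l//; lra.
  by apply: ler_pM => //; rewrite ler_wpM2l//; lra.
rewrite -mulrDr ler_wpM2l//; [lra|nra].
Qed.

Lemma cos_near0 : exists2 d : R, 0 < d & forall x, `|x| <= d -> 1 / 2 <= cos x.
Proof.
have h : (0 : R) < 1 / 2 by lra.
have /cvgrPdist_le/(_ _ h)/nbhs_ballP[e /= e0 H] := @continuous_cos R 0.
exists (e / 2); first by rewrite divr_gt0.
move=> x xe; have : `|cos 0 - cos x| <= 1 / 2.
  by apply: H; rewrite /ball/= sub0r normrN; apply: (le_lt_trans xe); lra.
by rewrite cos0 ler_norml => /andP[_]; lra.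
Qed.

End SymbolPhase.

(** * Lower bound for the second Picard iterate *)

Section PlaneSigmaFinite.
Variable R : realType.
Local Notation plane := (measurableTypeR R * measurableTypeR R)%type.

Lemma sigma_finite_leb2 : sigma_finite setT (leb2 R).
Proof.
pose I (n : nat) : set (measurableTypeR R) := `[- n%:R, n%:R]%classic.
have mI n : measurable (I n) by exact: measurable_itv.
exists (fun n => I n `*` I n).
  apply/esym; rewrite -subTset => z _.
  pose n := Num.bound (`|z.1| + `|z.2|).
  have h : `|z.1| + `|z.2| < n%:R by apply: archi_boundP; rewrite addr_ge0.
  have h1 := normr_ge0 z.1; have h2 := normr_ge0 z.2.
  by exists n => //; split; rewrite /I /= in_itv /= -ler_norml; lra.
move=> n; split; first exact: measurableX.
rewrite leb2_rect// lebesgue_measure_itv/=.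
by case: ifP => _; rewrite -?EFinB -?EFinM ltry.
Qed.

(** Tonelli's theorem asks for a sigma-finite structure, which the type of leb2 forgets. *)
Definition plane_measure : set plane -> \bar R := leb2 R.
HB.instance Definition _ := Measure.copy plane_measure (leb2 R).
HB.instance Definition _ :=
  Measure_isSigmaFinite.Build _ _ _ plane_measure sigma_finite_leb2.

End PlaneSigmaFinite.

Section Iterated.
Variable R : realType.
Implicit Types (N t s : R) (z k : R * R).
Local Notation plane := (measurableTypeR R * measurableTypeR R)%type.
Local Notation seg a b := (`[a, b]%classic : set (measurableTypeR R)).

Variables (N s d : R).
Hypotheses (N10 : 10 <= N) (s0 : 0 < s)
  (cosd : forall x : R, `|x| <= d -> 1 / 2 <= cos x) (sd : s * (5 * N ^+ 2) <= d).

Let c : R := 3 / 4 * (2 * pi) ^- 2.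

(** The support of the bump. *)
Definition window : set plane := seg 1 2 `*` seg 0 1.

Lemma windowP z : window z <-> 1 <= z.1 <= 2 /\ 0 <= z.2 <= 1.
Proof. by rewrite /window /setX/= !in_itv/=. Qed.

Lemma c_gt0 : 0 < c.
Proof.
by rewrite /c mulr_gt0// ?divr_gt0// invr_gt0 exprn_gt0// mulr_gt0// pi_gt0.
Qed.

(** On the window and before the phase exceeds d, the symbol is at least 1/2 and the cosine
    at least 1/2: there is no cancellation. *)
Lemma density_window t z k : window z -> 0 <= t <= s ->
  exists2 m : R, density N s z t k = m * pairchi N z k &
    (c / 4 <= m <= 3 * c \/ pairchi N z k = 0).
Proof.
move=> /windowP[hx hy] ht.
exists (c * ((z.1 * symRe k - z.2 * symIm k)
   * cos ((s - t) * NVphase z + pairphase t z k))).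
  by rewrite /density -/c; ring.
have [?|] := eqVneq (pairchi N z k) 0; first by right.
rewrite /pairchi mulf_eq0 negb_or => /andP[/chi_neq0[/= h1 h2] /chi_neq0[h3 h4]]; left.
have /andP[l1 l2] := symbol_bounds N10 hx hy h3 h4.
have := phase_bound N10 hx hy h3 h4 h1 h2 ht => /le_trans/(_ sd)/cosd => l3.
have l4 := cos_le1 ((s - t) * NVphase z + pairphase t z k).
have c0 := c_gt0.
set A := z.1 * _ - _ in l1 l2 *; set B := cos _ in l3 l4 *.
have : 1 / 4 <= A * B <= 3 by apply/andP; split; nra.
by move=> /andP[? ?]; apply/andP; split; nra.
Qed.

(** The density is signed in general; cutting it off to the output window and to the time
    interval makes it nonnegative, so that Tonelli's theorem applies. *)
Definition interaction (p : (plane * measurableTypeR R) * plane) : R :=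
  \1_window p.1.1 * \1_(seg 0 s) p.1.2 * density N s p.1.1 p.1.2 p.2.

Lemma interaction_ind z t k (P : R -> Prop) : P 0 ->
  (window z -> 0 <= t <= s -> P (density N s z t k)) -> P (interaction ((z, t), k)).
Proof.
move=> P0 PS; rewrite /interaction/= !indicE.
have [hz|hz] := boolP (z \in window); last by rewrite !mul0r.
have [ht|ht] := boolP (t \in seg 0 s); last by rewrite mulr0 mul0r.
by rewrite !mul1r; apply: PS; [exact/set_mem|move/set_mem: ht; rewrite /= in_itv].
Qed.

Lemma interaction_ge0 p : 0 <= interaction p.
Proof.
case: p => [[z t] k]; apply: (@interaction_ind z t k (fun v => 0 <= v)) => // hz ht.
have [m -> [/andP[m1 _]|->]] := density_window k hz ht; last by rewrite mulr0.
have := c_gt0; have := pairchi_ge0 N z k => h c0.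
by rewrite mulr_ge0//; lra.
Qed.

Lemma interaction_le z t k : interaction ((z, t), k) <= 3 * c * \1_(slab N `*` @strip R) k.
Proof.
have c0 := c_gt0.
apply: (@interaction_ind z t k (fun v => v <= _)) => [|hz ht].
  by rewrite mulr_ge0//; lra.
have [m -> [/andP[m1 m2]|->]] := density_window k hz ht; last by rewrite mulr0 mulr_ge0//; lra.
by rewrite ler_pM ?pairchi_ge0 ?pairchi_le//; lra.
Qed.

(** A set of inner frequencies k, of area 1, for which both k and z - k carry mass whatever
    z in the window: k lies in the left box and z - k in the right one. *)
Definition core : set plane := seg (- (N + 1)) (- N) `*` seg 0 1.

Lemma coreP k : core k <-> - (N + 1) <= k.1 <= - N /\ 0 <= k.2 <= 1.
Proof. by rewrite /core /setX/= !in_itv/=. Qed.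

Lemma bandP k : N <= `|k.1| <= N + 3 -> - 2 <= k.2 <= 2 -> (slab N `*` @strip R) k.
Proof. by move=> ? ?; split; rewrite /slab /strip /= ?in_itv. Qed.

Lemma pairchi_core z k : window z -> core k -> pairchi N z k = 1.
Proof.
have h10 := N10; move=> /windowP[/andP[x1 x2] /andP[y1 y2]].
move=> /coreP[/andP[a1 a2] /andP[b1 b2]].
have hk : (slab N `*` @strip R) k.
  apply: bandP; last by apply/andP; split; lra.
  by rewrite ler0_norm; [apply/andP; split|]; lra.
have hzk : (slab N `*` @strip R) (z - k).
  apply: bandP; last by apply/andP; split => /=; lra.
  by rewrite ger0_norm /=; [apply/andP; split|]; lra.
by rewrite /pairchi !chiE !indicE !mem_set ?mulr1.
Qed.

Lemma interaction_core z t k : window z -> 0 <= t <= s ->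
  c / 4 * \1_core k <= interaction ((z, t), k).
Proof.
move=> hz ht; rewrite {1}indicE.
have [/set_mem hk|_] := boolP (k \in core); last by rewrite mulr0 interaction_ge0.
have ht' : seg 0 s t by rewrite /= in_itv.
rewrite mulr1 /interaction/= !indicE (mem_set hz) (mem_set ht').
rewrite !mul1r; have [m -> ] := density_window k hz ht.
rewrite (pairchi_core hz hk) mulr1 => -[/andP[]//|/eqP]; by rewrite oner_eq0.
Qed.

Lemma measurable_interaction :
  measurable_fun [set: (plane * measurableTypeR R) * plane] interaction.
Proof.
pose space := ((plane * measurableTypeR R) * plane)%type.
have mseg (a b : R) : measurable (seg a b) by exact: measurable_itv.
have m1 : measurable_fun [set: space] (fun p => p.1.1).
  by apply: (measurableT_comp measurable_fst); exact: measurable_fst.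
have mx : measurable_fun [set: space] (fun p => p.1.1.1 : R).
  by apply: (measurableT_comp measurable_fst m1).
have my : measurable_fun [set: space] (fun p => p.1.1.2 : R).
  by apply: (measurableT_comp measurable_snd m1).
have mt : measurable_fun [set: space] (fun p => p.1.2 : R).
  by apply: (measurableT_comp measurable_snd); exact: measurable_fst.
have ma : measurable_fun [set: space] (fun p => p.2.1 : R).
  by apply: (measurableT_comp measurable_fst); exact: measurable_snd.
have mb : measurable_fun [set: space] (fun p => p.2.2 : R).
  by apply: (measurableT_comp measurable_snd); exact: measurable_snd.
rewrite (_ : interaction = (fun p => \1_window p.1.1 * \1_(seg 0 s) p.1.2 *
  (c * ((p.1.1.1 * symRe (p.2.1, p.2.2) - p.1.1.2 * symIm (p.2.1, p.2.2)) *
   cos ((s - p.1.2) * NVphase (p.1.1.1, p.1.1.2) +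
        pairphase p.1.2 (p.1.1.1, p.1.1.2) (p.2.1, p.2.2))
   * pairchi N (p.1.1.1, p.1.1.2) (p.2.1, p.2.2))))); last first.
  by apply/funext => -[[[x y] t] [a b]].
apply: measurable_funM.
  apply: measurable_funM.
    by apply: (measurableT_comp _ m1); apply: measurable_indic; exact: measurableX.
  by apply: (measurableT_comp _ mt); apply: measurable_indic.
apply: measurable_funM; first exact: measurable_cst.
apply: measurable_funM; last exact: measurable_pairchi.
apply: measurable_funM.
  apply: measurable_funB; apply: measurable_funM => //.
    exact: measurable_symRe.
  exact: measurable_symIm.
apply: measurable_cos; apply: measurable_funD; last exact: measurable_pairphase.
by apply: measurable_funM; [exact: measurable_funB|exact: measurable_NVphase].
Qed.

Definition interaction_rate (p : plane * measurableTypeR R) : R :=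
  Rintegral (leb2 R) setT (fun k => interaction (p, k)).

Definition interaction_total z : R :=
  Rintegral (@lebesgue_measure R) setT (fun t => interaction_rate (z, t)).

Lemma lebesgue_segment_fin (a b : R) : (lebesgue_measure (seg a b) < +oo)%E.
Proof. by rewrite lebesgue_measure_itv/=; case: ifP => _; rewrite -?EFinB ltry. Qed.

Lemma measurable_interaction_rate :
  measurable_fun [set: plane * measurableTypeR R] interaction_rate.
Proof.
exact: (@measurable_Rintegral_param _ _ _ _ _ (@plane_measure R) _
  measurable_interaction interaction_ge0).
Qed.

Lemma measurable_interaction_slice p :
  measurable_fun [set: plane] (fun k => interaction (p, k)).
Proof. exact: (measurable_fun_pair2 p measurable_interaction). Qed.

Lemma measurable_interaction_rate_slice z :
  measurable_fun [set: measurableTypeR R] (fun t => interaction_rate (z, t)).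
Proof. exact: (measurable_fun_pair2 (z : plane) measurable_interaction_rate). Qed.

(** 72 = 3 * 24, by [interaction_le] and [leb2_band]. *)
Lemma interaction_rate_bounds z t :
  0 <= interaction_rate (z, t) <= 72 * c * \1_(seg 0 s) t.
Proof.
have N0 : 0 <= N by exact: le_trans N10.
have c0 := c_gt0.
rewrite indicE; have [ht|ht] := boolP (t \in _); last first.
  rewrite mulr0 (_ : interaction_rate _ = 0) ?lexx// /interaction_rate.
  rewrite (_ : (fun k => _) = cst 0) ?Rintegral_cst ?mul0r//.
  by apply/funext => k; rewrite /interaction /= !indicE (negbTE ht) mulr0 mul0r.
rewrite mulr1.
have := @Rintegral_le_indic _ _ _ (leb2 R) (fun k => interaction ((z, t), k)) (3 * c) _
  (measurable_interaction_slice _) (measurable_band N) (band_fin N0).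
have -> : 72 * c = 3 * c * 24 by ring.
move=> /(_ _)/wrap[k|/andP[-> h]]; first by rewrite interaction_ge0 interaction_le.
apply: (le_trans h); rewrite ler_pM2l; last by rewrite mulr_gt0.
rewrite -lee_fin fineK ?leb2_band//.
by rewrite ge0_fin_numE// band_fin.
Qed.

Lemma interaction_rate_ge z t : window z -> 0 <= t <= s ->
  c / 4 <= interaction_rate (z, t).
Proof.
move=> hz ht; have N0 : 0 <= N by exact: le_trans N10.
have c0 := c_gt0.
have core1 : leb2 R core = 1%:E.
  rewrite leb2_rect; [|exact: measurable_itv|exact: measurable_itv].
  rewrite !lebesgue_segment ?ltr01//; last by rewrite ltrN2 ltrDl.
  by rewrite -EFinM; congr (_%:E); ring.
have := @Rintegral_ge_indic _ _ _ (leb2 R) (fun k => interaction ((z, t), k))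
  (3 * c) _ (c / 4) core (measurable_interaction_slice _) (measurable_band N) (band_fin N0).
rewrite core1 /= mulr1; apply => //.
- by apply: measurableX; exact: measurable_itv.
- by rewrite ltry.
- by move=> k; rewrite ger0_norm ?interaction_ge0// interaction_le.
- by move=> k; exact: interaction_core.
Qed.

Lemma interaction_total_bounds z : 0 <= interaction_total z <= 72 * c * s.
Proof.
have -> : 72 * c * s = 72 * c * fine (lebesgue_measure (seg 0 s)).
  by rewrite lebesgue_segment//= subr0.
apply: Rintegral_le_indic; first exact: measurable_interaction_rate_slice.
- exact: measurable_itv.
- exact: lebesgue_segment_fin.
- by move=> t; exact: interaction_rate_bounds.
Qed.

Lemma interaction_total_ge z : window z -> c / 4 * s <= interaction_total z.
Proof.
move=> hz; have -> : c / 4 * s = c / 4 * fine (lebesgue_measure (seg 0 s)).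
  by rewrite lebesgue_segment//= subr0.
apply: (@Rintegral_ge_indic _ _ _ _ _ (72 * c) (seg 0 s)).
- exact: measurable_interaction_rate_slice.
- exact: measurable_itv.
- exact: lebesgue_segment_fin.
- exact: measurable_itv.
- exact: lebesgue_segment_fin.
- by move=> t; have /andP[h0 h1] := interaction_rate_bounds z t; rewrite ger0_norm.
- move=> t; rewrite indicE; have [/set_mem ht|_] := boolP (t \in _).
    by rewrite mulr1; apply: interaction_rate_ge => //; move: ht; rewrite /= in_itv.
  by rewrite mulr0; have /andP[] := interaction_rate_bounds z t.
Qed.

Lemma measurable_interaction_total : measurable_fun [set: plane] interaction_total.
Proof.
apply: (@measurable_Rintegral_param _ _ _ _ _ lebesgue_measure _
  measurable_interaction_rate) => p.
by case: p => z t; have /andP[] := interaction_rate_bounds z t.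
Qed.

Lemma measurable_bump : measurable_fun [set: plane] (@bump R).
Proof.
have mflat n : measurable_fun [set: R] (@flat R n).
  by apply: continuous_measurable_fun; exact: flat_continuous.
have mx := @measurable_fst_plane R; have my := @measurable_snd_plane R.
apply: measurable_funM; apply: measurable_funM;
  apply: (measurableT_comp (mflat 0)) => //; exact: measurable_funB.
Qed.

Definition bump_floor : R := flat 0 (1 / 4) ^+ 4.

Lemma bump_floor_gt0 : 0 < bump_floor.
Proof. by rewrite exprn_gt0// flat0_gt0//; lra. Qed.

(** The last factor is the area of the square [5/4, 7/4] x [1/4, 3/4], on which the bump is
    at least bump_floor. *)
Lemma bump_interaction_ge : bump_floor * (c / 4 * s) * (1 / 4) <=
  Rintegral (leb2 R) setT (fun z => bump z * interaction_total z).
Proof.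
have c0 := c_gt0.
pose S : set plane := seg (5 / 4) (7 / 4) `*` seg (1 / 4) (3 / 4).
have area (a1 b1 a2 b2 : R) : a1 < b1 -> a2 < b2 ->
    leb2 R (seg a1 b1 `*` seg a2 b2) = ((b1 - a1) * (b2 - a2))%:E.
  move=> h1 h2; rewrite leb2_rect; [|exact: measurable_itv|exact: measurable_itv].
  by rewrite !lebesgue_segment// -EFinM.
have mseg2 (a1 b1 a2 b2 : R) : measurable (seg a1 b1 `*` seg a2 b2).
  by apply: measurableX; exact: measurable_itv.
have LB (z : R * R) : bump_floor * (c / 4 * s) * \1_S z <= bump z * interaction_total z.
  have /andP[k0 k1] := interaction_total_bounds z.
  rewrite indicE; have [/set_mem hz|_] := boolP (z \in S);
    last by rewrite mulr0 mulr_ge0 ?bump_ge0.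
  rewrite mulr1.
  have [hx hy] : 5 / 4 <= z.1 <= 7 / 4 /\ 1 / 4 <= z.2 <= 3 / 4.
    by move: hz; rewrite /S /setX/= !in_itv/=.
  have hw : window z.
    apply/windowP; move: hx hy => /andP[? ?] /andP[? ?].
    by split; apply/andP; split; lra.
  apply: ler_pM; [exact: ltW bump_floor_gt0| |exact: bump_ge|exact: interaction_total_ge].
  by rewrite mulr_ge0 ?(ltW s0)//; lra.
have -> : 1 / 4 = fine (leb2 R S) :> R by rewrite /S area/=; lra.
apply: (@Rintegral_ge_indic _ _ _ _ _ (72 * c * s) window).
- by apply: measurable_funM; [exact: measurable_bump|exact: measurable_interaction_total].
- exact: mseg2.
- by rewrite /window area ?ltry//; lra.
- exact: mseg2.
- by rewrite /S area ?ltry//; lra.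
- move=> z; have /andP[k0 k1] := interaction_total_bounds z.
  rewrite ger0_norm; last by rewrite mulr_ge0 ?bump_ge0.
  rewrite indicE.
  have [hz|hz] := boolP (z \in window).
    by rewrite mulr1 -[leRHS]mul1r ler_pM ?bump_ge0 ?bump_le1.
  rewrite (_ : bump z = 0) ?mul0r ?mulr0//; apply: contraNeq hz => /bump_support h.
  by rewrite inE; apply/windowP.
- exact: LB.
Qed.

End Iterated.

(** * Sobolev bounds *)

Section SobolevBounds.
Variable R : realType.
Implicit Types (N t s : R) (z k : R * R).
Local Notation plane := (measurableTypeR R * measurableTypeR R)%type.

Lemma Lnorm2_le_indic d (T : measurableType d) (m : {measure set T -> \bar R})
  (f : T -> R) (M L : R) (E : set T) :
  measurable_fun [set: T] f -> measurable E -> 0 <= M -> 0 <= L ->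
  (m E <= (L ^+ 2)%:E)%E -> (forall x, `|f x| <= M * \1_E x) ->
  (Lnorm m 2%:E (EFin \o f) <= (M * L)%:E)%E.
Proof.
move=> mf mE M0 L0 mEL fE; rewrite unlock.
have ML : 0 <= M * L by rewrite mulr_ge0.
have -> : ((M * L)%:E = ((M * L) ^+ 2)%:E `^ (2^-1))%E.
  rewrite poweR_EFin -powR_mulrn// -powRrM mulfV ?powRr1//.
apply: gt0_ler_poweR; rewrite ?invr_ge0//.
- by rewrite in_itv/= leey integral_ge0// => x _; exact: poweR_ge0.
- by rewrite in_itv/= leey lee_fin sqr_ge0.
rewrite (eq_integral (fun x => (`|f x| ^+ 2)%:E)); last first.
  by move=> x _; rewrite /= powR_mulrn.
apply: (@le_trans _ _ (\int[m]_x ((M ^+ 2)%:E * (\1_E x)%:E))%E).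
  apply: ge0_le_integral => //.
  - apply/measurable_EFinP; apply: measurable_funX.
    by apply: (measurableT_comp _ mf); exact: normr_measurable.
  - apply/measurable_EFinP; apply: measurable_funM; first exact: measurable_cst.
    exact: measurable_indic.
  - move=> x _; rewrite -EFinM lee_fin.
    have := fE x; rewrite indicE; case: (x \in E) => /= h; rewrite ?mulr1 ?mulr0 in h *.
      by rewrite lerXn2r.
    have -> : `|f x| = 0 by apply/eqP; rewrite eq_le h normr_ge0.
    by rewrite expr0n.
rewrite ge0_integralZl_EFin ?sqr_ge0//; last exact/measurable_EFinP/measurable_indic.
rewrite integral_indic// setIT exprMn (EFinM (M ^+ 2)).
by apply: lee_wpmul2l => //; rewrite lee_fin sqr_ge0.
Qed.

Lemma measurable_enorm2 : measurable_fun [set: plane] (@enorm2 R).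
Proof.
rewrite (_ : @enorm2 R = (fun x => x `^ (2^-1)) \o (fun z : plane => z.1 ^+ 2 + z.2 ^+ 2)).
  apply: measurableT_comp; first exact: measurable_powR.
  by apply: measurable_normsq; [exact: measurable_fst_plane|exact: measurable_snd_plane].
by apply/funext => z /=; rewrite powR12_sqrt// addr_ge0// sqr_ge0.
Qed.

Lemma enorm2_ge z : `|z.1| <= enorm2 z.
Proof. by rewrite -sqrtr_sqr ler_sqrt ?addr_ge0 ?sqr_ge0// lerDl sqr_ge0. Qed.

Lemma enorm2_le z : enorm2 z <= `|z.1| + `|z.2|.
Proof.
have h : 0 <= `|z.1| + `|z.2| by rewrite addr_ge0.
rewrite -[leRHS]ger0_norm// -sqrtr_sqr ler_sqrt ?sqr_ge0//.
rewrite sqrrD !real_normK ?num_real// -addrA lerD2l lerDr.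
by rewrite mulrn_wge0// mulr_ge0.
Qed.

Lemma chiN N z : chi N (- z) = chi N z.
Proof.
have E (P : set R) (x : R) : (forall x, P x <-> P (- x)) -> \1_P (- x) = \1_P x :> R.
  move=> h; rewrite !indicE; congr (nat_of_bool _)%:R.
  by apply/idP/idP => /set_mem/h; rewrite ?opprK => ?; rewrite inE.
rewrite /chi /= !E// => x; first by rewrite /strip/= !in_itv/= -!ler_norml normrN.
by rewrite /slab/= normrN.
Qed.

Lemma powR_le_neg s N x : s < 0 -> 0 < N -> N <= x -> x `^ s <= N `^ s.
Proof.
move=> s0 N0 Nx; have x0 : 0 < x by exact: lt_le_trans Nx.
rewrite -[s]opprK !(powRN _ (- s)) lef_pV2 ?posrE ?powR_gt0//.
by apply: ge0_ler_powR; rewrite ?nnegrE ?oppr_ge0 ?(ltW s0) ?(ltW N0) ?(ltW x0).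
Qed.

Lemma cmeasurable_datum N : cmeasurable (@datum R N).
Proof.
split => /=; last exact: measurable_cst.
rewrite (_ : (fun z => _) = (fun z => chi N (z.1, z.2))); last by apply/funext => -[].
by apply: measurable_chi; [exact: measurable_fst_plane|exact: measurable_snd_plane].
Qed.

Lemma cmod_real (r : R) : cmod r%:C = `|r|.
Proof. by rewrite /cmod /= expr0n addr0 sqrtr_sqr. Qed.

(** On the support of the datum the weight is at most N `^ s, because s < 0; the constant
    5 exceeds the square root of the area. *)
Lemma Hnorm_datum s N : s < 0 -> 0 < N -> (Hnorm s (datum N) <= (N `^ s * 5)%:E)%E.
Proof.
move=> s0 N0.
apply: (Lnorm2_le_indic _ (measurable_band N)) => //.
- apply: measurable_funM.
    by apply: (measurableT_comp (measurable_powR _)); exact: measurable_enorm2.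
  under eq_fun do rewrite cmod_real ger0_norm ?chi_ge0//.
  by have [] := cmeasurable_datum N.
- exact: powR_ge0.
- by apply: (le_trans (leb2_band (ltW N0))); rewrite lee_fin; lra.
- move=> z; rewrite cmod_real (ger0_norm (chi_ge0 _ _)) -chiE.
  rewrite ger0_norm ?mulr_ge0 ?powR_ge0 ?chi_ge0//.
  have [->|/chi_neq0[/andP[h _] _]] := eqVneq (chi N z) 0; first by rewrite !mulr0.
  rewrite ler_wpM2r ?chi_ge0//; apply: powR_le_neg => //.
  exact: le_trans (enorm2_ge z).
Qed.

Lemma Hs_datum s N : s < 0 -> 0 < N -> Hs s (datum N).
Proof.
move=> s0 N0; split; first exact: cmeasurable_datum.
  by apply: aeW => z; rewrite /datum chiN conjc_real.
by apply: (le_lt_trans (Hnorm_datum s0 N0)); rewrite ltry.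
Qed.

Lemma Im_le_cmod (a : R[i]) : `|complex.Im a| <= cmod a.
Proof.
case: a => x y; rewrite /cmod /= -sqrtr_sqr ler_sqrt ?addr_ge0 ?sqr_ge0//.
by rewrite lerDr sqr_ge0.
Qed.

Lemma measurable_cmod f : cmeasurable f -> measurable_fun [set: plane] (fun z => cmod (f z)).
Proof.
move=> [m1 m2].
rewrite (_ : (fun z => _) = (fun x => x `^ (2^-1)) \o
  (fun z : plane => complex.Re (f z) ^+ 2 + complex.Im (f z) ^+ 2)).
  by apply: measurableT_comp; [exact: measurable_powR|exact: measurable_normsq].
by apply/funext => z /=; rewrite powR12_sqrt ?addr_ge0 ?sqr_ge0//; case: (f z).
Qed.

(** Cauchy-Schwarz, with the weight |z| `^ s moved onto the bump.  The bump vanishes near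
    the origin, and |z| <= 3 on its support. *)
Lemma bump_pairing_le s w : s < 0 -> cmeasurable w ->
  (`|Rintegral (leb2 R) setT (fun z => bump z * complex.Im (w z))|%:E
    <= (3 `^ (- s))%:E * Hnorm s w)%E.
Proof.
move=> s0 mw; have [m1 m2] := mw.
pose F z : R := enorm2 z `^ s * cmod (w z).
pose G z : R := bump z * enorm2 z `^ (- s).
have mF : measurable_fun [set: plane] F.
  apply: measurable_funM; last exact: measurable_cmod.
  by apply: (measurableT_comp (measurable_powR _)); exact: measurable_enorm2.
have mG : measurable_fun [set: plane] G.
  apply: measurable_funM; first exact: measurable_bump.
  by apply: (measurableT_comp (measurable_powR _)); exact: measurable_enorm2.
have mI : measurable_fun [set: plane] (fun z => bump z * complex.Im (w z)).
  by apply: measurable_funM => //; exact: measurable_bump.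
have GB z : `|G z| <= 3 `^ (- s) * \1_(@window R) z.
  rewrite /G ger0_norm; last by rewrite mulr_ge0 ?bump_ge0 ?powR_ge0.
  rewrite indicE.
  have [hz|hz] := boolP (z \in @window R); last first.
    rewrite (_ : bump z = 0) ?mul0r ?mulr0//; apply: contraNeq hz => /bump_support h.
    by rewrite inE; apply/windowP.
  rewrite mulr1 -[leRHS]mul1r ler_pM ?bump_ge0 ?bump_le1 ?powR_ge0//.
  move/set_mem/windowP: hz => [/andP[x1 x2] /andP[y1 y2]].
  apply: ge0_ler_powR; rewrite ?nnegrE ?oppr_ge0 ?(ltW s0)//; first exact: sqrtr_ge0.
  by apply: (le_trans (enorm2_le z)); rewrite !ger0_norm; lra.
have G3 : (Lnorm (leb2 R) 2%:E (EFin \o G) <= (3 `^ (- s) * 1)%:E)%E.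
  apply: (@Lnorm2_le_indic _ _ _ _ _ _ (@window R)) => //.
  - by apply: measurableX; exact: measurable_itv.
  - rewrite /window leb2_rect; [|exact: measurable_itv|exact: measurable_itv].
    rewrite !lebesgue_segment ?ltr01 ?ltr1n// -EFinM lee_fin; lra.
have H := @hoelder _ _ _ (leb2 R) F G 2 2 mF mG ltac:(by []) ltac:(by []) ltac:(lra).
apply: (@le_trans _ _ (Lnorm (leb2 R) 1 (EFin \o (F \* G)%R))); last first.
  apply: (le_trans H); rewrite muleC; apply: lee_pmul => //; rewrite ?Lnorm_ge0//.
  by rewrite -[X in (_ <= X%:E)%E]mulr1.
rewrite Lnorm1.
apply: (@le_trans _ _ (`|\int[leb2 R]_z (bump z * complex.Im (w z))%:E|)%E).
  by rewrite /Rintegral; case: (integral _ _ _) => [r| |] //=; rewrite normr0 ?le0y.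
apply: le_trans (le_abse_integral _ measurableT _) _; first exact/measurable_EFinP.
apply: ge0_le_integral => //.
- by apply: (measurableT_comp (@abse_measurable _ _)) => //; exact/measurable_EFinP.
- apply: (measurableT_comp (@abse_measurable _ _)) => //.
  by apply/measurable_EFinP; exact: measurable_funM.
- move=> z _; rewrite /= lee_fin (normrM (bump z)) (ger0_norm (bump_ge0 z)).
  have [->|/bump_support[/andP[x1 _] _]] := eqVneq (bump z) 0; first by rewrite mul0r.
  have e0 : 0 < enorm2 z.
    apply: lt_le_trans (enorm2_ge z); rewrite normr_gt0.
    by apply/eqP => e; rewrite e ler10 in x1.
  have E0 : enorm2 z `^ s != 0 by rewrite gt_eqF// powR_gt0.
  have -> : F z * G z = bump z * cmod (w z) by rewrite /F /G powRN; field.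
  have c0 : 0 <= cmod (w z) by case: (w z) => a b; exact: sqrtr_ge0.
  rewrite (ger0_norm (mulr_ge0 (bump_ge0 z) c0)).
  by rewrite ler_wpM2l ?bump_ge0// Im_le_cmod.
Qed.

End SobolevBounds.

(** * Passing from truncations to the Duhamel integral *)

Section Identification.
Variable R : realType.
Implicit Types (N t s T rho : R) (z k : R * R) (u : R -> R * R -> R[i]).
Local Notation plane := (measurableTypeR R * measurableTypeR R)%type.

Lemma cmeasurable_cexp (a : R * R -> R) : measurable_fun [set: plane] a ->
  cmeasurable (fun z => cexp (a z)).
Proof. by move=> ma; split; [exact: measurable_cos|exact: measurable_sin]. Qed.

Lemma cmeasurable_NVflow t f : cmeasurable f -> cmeasurable (NVflow t f).
Proof.
move=> mf; apply: cmeasurableM => //; apply: cmeasurable_cexp.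
apply: measurable_funM; first exact: measurable_cst.
rewrite (_ : @NVphase R = (fun z => NVphase (z.1, z.2))); last by apply/funext => -[].
by apply: measurable_NVphase; [exact: measurable_fst_plane|exact: measurable_snd_plane].
Qed.

Lemma cmeasurable_cutoff rho f : cmeasurable f -> cmeasurable (cutoff rho f).
Proof.
pose B : set plane := (@enorm2 R) @^-1` `]-oo, rho]%classic.
have mB : measurable B.
  by rewrite -[X in measurable X]setTI; apply: measurable_enorm2 => //; exact: measurable_itv.
rewrite (_ : cutoff rho f = (fun z => (\1_B z)%:C * f z)); last first.
  apply/funext => z; rewrite /cutoff indicE.
  have -> : (z \in B) = (enorm2 z <= rho).
    by apply/idP/idP => [/set_mem|h]; [|apply: mem_set]; rewrite /B/= in_itv.
  by case: ifP => _; rewrite ?mul1r ?mul0r.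
move=> mf; apply: cmeasurableM => //; split => /=; last exact: measurable_cst.
exact: measurable_indic.
Qed.

(** The datum is supported in |z| <= (N + 3) + 2. *)
Lemma cutoff_datum_ae N t rho (v : R * R -> R[i]) : N + 5 <= rho ->
  eqae v (NVflow t (datum N)) -> eqae (cutoff rho v) (NVflow t (datum N)).
Proof.
move=> hrho; apply: (@filterS _ _ (ae_filter_ringOfSetsType (leb2 R))) => z /= vz.
rewrite /cutoff; case: ifPn => // /negP hz.
rewrite /NVflow /datum (_ : chi N z = 0) ?mulr0//.
apply/eqP/negPn/negP => /chi_neq0[/andP[_ h1] h2]; apply: hz.
by apply: (le_trans (enorm2_le z)); lra.
Qed.

Lemma eq_cint1 (D : set R) (h1 h2 : R -> R[i]) : {in D, h1 =1 h2} ->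
  cint1 D h1 = cint1 D h2.
Proof. by move=> h; rewrite /cint1; congr (_ +i* _); apply: eq_Rintegral => t /h ->. Qed.

(** For a free wave with compactly supported transform, truncation at a high frequency does
    nothing, so the truncated Duhamel integrals form an eventually constant family. *)
Lemma duhamel_cut_datum N t rho u : N + 5 <= rho ->
  (forall t', t' \in `[0, t] -> cmeasurable (u t') /\ eqae (u t') (NVflow t' (datum N))) ->
  duhamel_cut rho u t = (fun z => cint1 `[0, t] (fun t' => NVflow (t - t')
    (fun z' => NL1 (NVflow t' (datum N)) z' + NL2 (NVflow t' (datum N)) z') z)).
Proof.
move=> hrho hu; apply/funext => z; rewrite /duhamel_cut.
apply: eq_cint1 => t'; rewrite inE => /hu[mu hut].
rewrite [LHS]/NVflow [RHS]/NVflow; congr (_ * _); apply: NL_ae.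
- exact: cmeasurable_cutoff.
- exact: cmeasurable_NVflow (cmeasurable_datum N).
- exact: cutoff_datum_ae.
Qed.

Lemma Im_duhamel_datum N s z : 0 <= N -> window z ->
  complex.Im (cint1 `[0, s] (fun t' => NVflow (s - t')
    (fun z' => NL1 (NVflow t' (datum N)) z' + NL2 (NVflow t' (datum N)) z') z))
  = interaction_total N s z.
Proof.
move=> N0 hz; rewrite /cint1 /= /interaction_total Rintegral_mkcond.
apply: eq_Rintegral => t _; rewrite patchE /interaction_rate.
case: ifPn => ht.
  apply: (etrans (Im_nonlinearity s t z N0)); apply: eq_Rintegral => k _.
  by rewrite /interaction /= !indicE (mem_set hz) ht !mul1r.
rewrite (_ : (fun k => _) = cst 0) ?Rintegral_cst ?mul0r//.
by apply/funext => k; rewrite /interaction /= !indicE (negbTE ht) mulr0 mul0r.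
Qed.

Lemma Im_cint2_bump (v : R * R -> R[i]) :
  complex.Im (cint2 (fun z => (bump z)%:C * v z)) =
  Rintegral (leb2 R) setT (fun z => bump z * complex.Im (v z)).
Proof.
rewrite /cint2 [LHS]/=; apply: eq_Rintegral => z _.
by rewrite ImM [complex.Im _]/= mul0r addr0.
Qed.

(** The only access to the Duhamel integral w is through test functions; the bump is one. *)
Lemma duhamel_pairing N s T u w : 0 <= N -> s \in `[0, T] ->
  (forall t', t' \in `[0, T] -> cmeasurable (u t') /\ eqae (u t') (NVflow t' (datum N))) ->
  is_duhamel T u w ->
  Rintegral (leb2 R) setT (fun z => bump z * interaction_total N s z) =
  Rintegral (leb2 R) setT (fun z => bump z * complex.Im (w s z)).
Proof.
move=> N0 hs hu /(_ s hs _ (bump_test R)) lim0.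
pose D := fun z => cint1 `[0, s] (fun t' => NVflow (s - t')
    (fun z' => NL1 (NVflow t' (datum N)) z' + NL2 (NVflow t' (datum N)) z') z).
pose X := cint2 (fun z => (bump z)%:C * D z).
pose Y := cint2 (fun z => (bump z)%:C * w s z).
(* The truncated pairings are constant for rho >= N + 5, so their limit is their value. *)
have limc : (fun rho => cmod (cint2 (fun z => (bump z)%:C * duhamel_cut rho u s z) - Y))
    @ +oo --> cmod (X - Y).
  apply: cvg_near_cst; near=> rho.
  rewrite (@duhamel_cut_datum N); last first.
    move=> t' ht'; apply: hu; move: ht' hs; rewrite !in_itv/= => /andP[h1 h2] /andP[h3 h4].
    by rewrite h1/=; exact: le_trans h4.
    by near: rho; apply: nbhs_pinfty_ge; rewrite num_real.
  by [].
have : cmod (X - Y) = 0 by exact: (cvg_unique _ limc lim0).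
move/ComplexField.Normc.eq0_normc => /eqP; rewrite subr_eq0 => /eqP XY.
have := congr1 (@complex.Im R) XY; rewrite /X /Y !Im_cint2_bump => <-.
apply: eq_Rintegral => z _.
have [b0|/bump_support/windowP hz] := eqVneq (bump z) 0; first by rewrite b0 !mul0r.
by rewrite /D Im_duhamel_datum.
Unshelve. all: by end_near. Qed.

End Identification.

(** * Ill-posedness *)

Section Conclusion.
Variable R : realType.
Implicit Types (N t s T : R).

(** At the time t = d / (5 N^2) allowed by [phase_bound], the second Picard iterate has size
    at least of order t.  N0 is chosen so that t is at most T. *)
Lemma picard_lower_bound (T : R) : 0 < T ->
  exists c0 : R, 0 < c0 /\ exists N0 : R, 10 <= N0 /\
  forall N, N0 <= N -> exists t : R, t \in `[0, T] /\
    c0 * N ^- 2 <= Rintegral (leb2 R) setT (fun z => bump z * interaction_total N t z).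
Proof.
move=> T0; have [d d0 hd] := @cos_near0 R.
pose c : R := 3 / 4 * (2 * pi) ^- 2.
have cp : 0 < c by exact: c_gt0.
have kp := bump_floor_gt0 R.
(* 80 = 5 * 4 * 4: the 5 of the time t, the lower bound c / 4 of the density and the
   area 1 / 4 of the square on which the bump is bounded below. *)
exists (bump_floor R * c * d / 80); split; first by rewrite divr_gt0// mulr_gt0// mulr_gt0.
exists (10 + d / (5 * T)); split; first by rewrite lerDl divr_ge0 ?mulr_ge0// ltW.
move=> N hN.
have dT : 0 < d / (5 * T) by rewrite divr_gt0// mulr_gt0.
have N10 : 10 <= N by lra.
have N0 : 0 < N by lra.
have N2 : 0 < N ^+ 2 by rewrite exprn_gt0.
(* The longest time for which [phase_bound] keeps the phase below d. *)
pose t := d / (5 * N ^+ 2).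
have t0 : 0 < t by rewrite divr_gt0// mulr_gt0.
exists t; split.
  rewrite in_itv/= (ltW t0)/= ler_pdivrMr ?mulr_gt0//.
  have : d / (5 * T) <= N ^+ 2 by nra.
  by rewrite ler_pdivrMr ?mulr_gt0//; lra.
have td : t * (5 * N ^+ 2) <= d by rewrite /t divfK// gt_eqF// mulr_gt0.
have low := bump_interaction_ge N10 t0 hd td; apply: (le_trans _ low).
by rewrite /t -/c le_eqVlt; apply/orP; left; apply/eqP; field; rewrite !gt_eqF// pi_gt0.
Qed.

(** N^(2 s) is negligible with respect to N^-2 exactly because s < -1. *)
Lemma powers_incompatible s (c0 A N0 : R) : s < -1 -> 0 < c0 -> 10 <= N0 ->
  exists2 N, N0 <= N & A * (N `^ s) ^+ 2 < c0 * N ^- 2.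
Proof.
move=> hs c00 N010.
pose p := - 2 - 2 * s; have p0 : 0 < p by rewrite /p; lra.
pose B := `|A| / c0 + 1.
have B1 : 1 <= B by rewrite lerDr divr_ge0 ?normr_ge0// ltW.
(* Chosen so that N `^ p >= B. *)
pose N := N0 + B `^ (p^-1).
have Npos : 0 < N by rewrite /N ltr_wpDr ?powR_ge0//; lra.
exists N; first by rewrite lerDl powR_ge0.
have NB : B <= N `^ p.
  rewrite -[leLHS]powRr1; last lra.
  rewrite -(mulVf (lt0r_neq0 p0)) powRrM; apply: ge0_ler_powR;
    rewrite ?nnegrE ?powR_ge0 ?(ltW p0) ?(ltW Npos)//.
  by rewrite /N lerDr; lra.
have Nsp : 0 < N `^ s by exact: powR_gt0.
have E : N `^ p * (N `^ s) ^+ 2 = N ^- 2.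
  rewrite -powR_mulrn ?powR_ge0// -powRrM -powRD; last by rewrite (gt_eqF Npos) implybT.
  by rewrite /p (_ : - 2 - 2 * s + s * 2 = - 2); [rewrite powRN powR_mulrn// ltW|ring].
rewrite -E mulrA ltr_pM2r ?exprn_gt0//.
apply: (@lt_le_trans _ _ (c0 * B)); last by rewrite ler_pM2l.
rewrite /B mulrDr mulrCA divff ?gt_eqF// !mulr1.
by apply: (le_lt_trans (ler_norm A)); lra.
Qed.

End Conclusion.

Theorem theorem3 (R : realType) (s T : R) (hs : s < -1) (hT : 0 < T) :
  ~ exists (X : normedModType R) (iota : X -> R -> R * R -> R[i]),
      continuously_embedded s T iota /\
      exists C : R, 0 < C /\
        linear_estimate s T iota C /\ quadratic_estimate T iota C.
Proof.
move=> [X [iota [[emb _ _ [K hK]] [C [C0 [lin quad]]]]]].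
have s0 : s < 0 by lra.
have [c0 [c00 [N0 [N010 low]]]] := picard_lower_bound hT.
(* Constants of the pairing with the bump, the embedding, the quadratic estimate and,
   squared, the linear estimate applied to the datum. *)
pose A := 3 `^ (- s) * (`|K| * (C * (C * 5) ^+ 2)).
have [N N0N] := powers_incompatible A hs c00 N010.
apply/negP; rewrite -leNgt.
have Np : 0 < N by lra.
have [t [ht lowt]] := low N N0N.
have [x [xflow xC]] := lin _ (Hs_datum s0 Np).
have [y [yduh yC]] := quad x.
have hu t' : t' \in `[0, T] ->
    cmeasurable (iota x t') /\ eqae (iota x t') (NVflow t' (datum N)).
  by move=> ht'; split; [have [+ _] := emb x => /(_ _ ht')[]|exact: xflow].
apply: (le_trans lowt); rewrite (duhamel_pairing (ltW Np) ht hu yduh).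
apply: (le_trans (ler_norm _)).
have [my _ _] : Hs s (iota y t) by have [+ _] := emb y; apply.
rewrite -lee_fin; apply: (le_trans (bump_pairing_le s0 my)).
have xN : `|x| <= C * 5 * N `^ s.
  rewrite -lee_fin; apply: (le_trans xC).
  rewrite (_ : C * 5 * N `^ s = C * (N `^ s * 5)); last by ring.
  by rewrite EFinM lee_wpmul2l ?lee_fin ?(ltW C0)// Hnorm_datum.
have yN : `|y| <= C * (C * 5 * N `^ s) ^+ 2.
  apply: (le_trans yC); rewrite ler_wpM2l ?(ltW C0)//.
  by rewrite lerXn2r// nnegrE// (le_trans _ xN).
have wN : (Hnorm s (iota y t) <= (`|K| * (C * (C * 5 * N `^ s) ^+ 2))%:E)%E.
  apply: (le_trans (hK y t ht)); rewrite lee_fin.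
  apply: (le_trans (ler_norm _)); rewrite normrM normr_id.
  by rewrite ler_wpM2l.
rewrite (_ : A * _ = 3 `^ (- s) * (`|K| * (C * (C * 5 * N `^ s) ^+ 2)));
  last by rewrite /A; ring.
by rewrite EFinM lee_wpmul2l// lee_fin powR_ge0.
Qed.
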